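(* Let $F_{\mathfrak{p}}$ be a local function field containing $\mathbb{F}$ with valuation ring $\mathcal{O}_{\mathfrak{p}}$, $\kappa:A\to\mathcal{O}_{\mathfrak{p}}$ an $\mathbb{F}$-algebra morphism, $\underline{M}$ an $A$-motive over $F_{\mathfrak{p}}$, and $\ell$ a maximal ideal of $A$ with $\kappa(\ell)\mathcal{O}_{\mathfrak{p}}=\mathcal{O}_{\mathfrak{p}}$. Then $\operatorname{Ext}^1_{\mathcal{O}_{\mathfrak{p}}}(\mathbbm{1},\underline{M})\subseteq\operatorname{Ext}^1_{\mathrm{good}}(\mathbbm{1},\underline{M})_\ell$.
   Context: $\mathbb{F}$ finite with $q$ elements; $A=\Gamma(C\setminus\{\infty\},\mathcal{O}_C)$ for a geometrically irreducible smooth projective curve $C/\mathbb{F}$ and closed point $\infty$; tensor products over $\mathbb{F}$. $\tau(a\otimes x)=a\otimes x^q$; $\mathfrak{j}$ generated by $a\otimes1-1\otimes\kappa(a)$; $L[\mathfrak{j}^{-1}]$ obtained by inverting $\mathfrak{j}$. An $A$-motive over $F_{\mathfrak{p}}$ is $(M,\tau_M)$ with $M$ locally free of finite constant rank over $A\otimes F_{\mathfrak{p}}$ and $\tau_M:(\tau^*M)[\mathfrak{j}^{-1}]\xrightarrow{\sim}M[\mathfrak{j}^{-1}]$; $\mathbbm{1}=(A\otimes F_{\mathfrak{p}},\mathbf{1})$. $\operatorname{Ext}^1(\mathbbm{1},\underline{M})$ is the Yoneda Ext in the exact category of $A$-motives over $F_{\mathfrak{p}}$ (exact sequences: exact on underlying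 modules); $\iota:M[\mathfrak{j}^{-1}]\to\operatorname{Ext}^1(\mathbbm{1},\underline{M})$ sends $m$ to the class of $(M\oplus(A\otimes F_{\mathfrak{p}}),\begin{pmatrix}\tau_M&m\mathbf{1}\\0&\mathbf{1}\end{pmatrix})$; it is surjective. $M_{\mathcal{O}_{\mathfrak{p}}}$ is the maximal $\mathcal{O}_{\mathfrak{p}}$-model of $\underline{M}$: the largest finitely generated $A\otimes\mathcal{O}_{\mathfrak{p}}$-submodule $L\subset M$ generating $M$ with $\tau_M(\tau^*L)\subset L[\mathfrak{j}^{-1}]$; $\operatorname{Ext}^1_{\mathcal{O}_{\mathfrak{p}}}(\mathbbm{1},\underline{M}):=\iota(M_{\mathcal{O}_{\mathfrak{p}}}[\mathfrak{j}^{-1}])$. Let $F_{\mathfrak{p}}^s$ be a separable closure, $G_{\mathfrak{p}}$ its Galois group with inertia subgroup $I_{\mathfrak{p}}$, $\mathcal{O}_\ell$ the completion of $A$ at $\ell$, $\mathcal{A}_\ell(F^s_{\mathfrak{p}})=\varprojlim_n(A\otimes F^s_{\mathfrak{p}})/\ell^n$, and $T_\ell\underline{M}=\{m\in M\otimes_{A\otimes F_{\mathfrak{p}}}\mathcal{A}_\ell(F^s_{\mathfrak{p}}):\tau_M(\tau^*m)=m\}$, a continuous $\mathcal{O}_\ell$-linear $G_{\mathfrak{p}}$-representation; $T_\ell$ is an exact functor, so an extension $0\to\underline{M}\to\underline{E}\to\mathbbm{1}\to0$ yields an extension $0\to T_\ell\underline{M}\to T_\ell\underline{E}\to\mathcal{O}_\ell\to0$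 of representations and hence a class in $H^1(I_{\mathfrak{p}},T_\ell\underline{M})$. $\operatorname{Ext}^1_{\mathrm{good}}(\mathbbm{1},\underline{M})_\ell$ is the kernel of the resulting $A$-linear map $\operatorname{Ext}^1(\mathbbm{1},\underline{M})\to H^1(I_{\mathfrak{p}},T_\ell\underline{M})$. *)

(* Defs.v *)
From HB Require Import structures.
From mathcomp Require Import all_boot all_order all_algebra all_field.
From mathcomp Require Import boolp classical_sets.

Set Implicit Arguments.
Unset Strict Implicit.
Unset Printing Implicit Defensive.

Import Order.TTheory GRing.Theory Num.Theory.

Local Open Scope classical_set_scope.
Local Open Scope quotient_scope.
Local Open Scope ring_scope.

Section Tensor.
Variables (R : Type) (M N : zmodType) (aM : R -> M -> M) (aN : R -> N -> N).

Definition balanced (P : zmodType) (phi : M -> N -> P) : Prop :=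
  [/\ forall n, {morph phi^~ n : x y / x + y},
      forall m, {morph phi m : x y / x + y}
    & forall r m n, phi (aM r m) n = phi m (aN r n)].

Definition tsum (P : zmodType) (phi : M -> N -> P) (s : seq (M * N)) : P :=
  \sum_(x <- s) phi x.1 x.2.

(* Formal sums of pairs, modulo the universal property: two formal sums are
   identified iff every balanced biadditive map takes the same value on them. *)
Definition tens_eq (s t : seq (M * N)) : bool :=
  `[< forall (P : zmodType) (phi : M -> N -> P), balanced phi ->
        tsum phi s = tsum phi t >].

Lemma tens_eq_refl : reflexive tens_eq.
Proof. by move=> s; apply/asboolP. Qed.

Lemma tens_eq_sym : symmetric tens_eq.
Proof.
by move=> s t; apply/asboolP/asboolP => h P phi b; rewrite h.
Qed.

Lemma tens_eq_trans : transitive tens_eq.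
Proof.
move=> s t u /asboolP h1 /asboolP h2; apply/asboolP => P phi b.
by rewrite h1 ?h2.
Qed.

Canonical tens_eq_equiv := EquivRel tens_eq tens_eq_refl tens_eq_sym tens_eq_trans.

Definition tens : Type := {eq_quot tens_eq}.
HB.instance Definition _ := Choice.on tens.

Definition tcls (s : seq (M * N)) : tens := \pi_{eq_quot tens_eq} s.
Definition trep (x : tens) : seq (M * N) := repr (x : {eq_quot tens_eq}).

Definition tpure (m : M) (n : N) : tens := tcls [:: (m, n)].

(* The additive map induced by phi (meaningful when phi is balanced). *)
Definition tlift (P : zmodType) (phi : M -> N -> P) (x : tens) : P :=
  tsum phi (trep x).

Lemma trepK x : tcls (trep x) = x.
Proof. exact: reprK. Qed.

Lemma tcls_eq s t :
  (forall (P : zmodType) (phi : M -> N -> P), balanced phi ->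
     tsum phi s = tsum phi t) -> tcls s = tcls t.
Proof. by move=> h; apply/eqmodP/asboolP. Qed.

Lemma tlift_cls (P : zmodType) (phi : M -> N -> P) s :
  balanced phi -> tlift phi (tcls s) = tsum phi s.
Proof.
move=> b; rewrite /tlift.
have /eqmodP /asboolP h : tcls (trep (tcls s)) = tcls s by rewrite trepK.
exact: h.
Qed.

Definition tadd (x y : tens) : tens := tcls (trep x ++ trep y).
Definition topp (x : tens) : tens := tcls [seq (- z.1, z.2) | z <- trep x].
Definition tzero : tens := tcls [::].

Lemma tsum_cat (P : zmodType) (phi : M -> N -> P) s t :
  tsum phi (s ++ t) = tsum phi s + tsum phi t.
Proof. exact: big_cat. Qed.

Lemma balancedNl (P : zmodType) (phi : M -> N -> P) m n :
  balanced phi -> phi (- m) n = - phi m n.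
Proof.
move=> [h _ _]; apply/eqP; rewrite -addr_eq0 -h addNr; apply/eqP.
by apply: (addrI (phi 0 n)); rewrite -h !addr0.
Qed.

Lemma tsum_opp (P : zmodType) (phi : M -> N -> P) s :
  balanced phi -> tsum phi [seq (- z.1, z.2) | z <- s] = - tsum phi s.
Proof.
move=> b; rewrite /tsum big_map -sumrN; apply: eq_bigr => z _ /=.
exact: balancedNl.
Qed.

Lemma taddE s t : tadd (tcls s) (tcls t) = tcls (s ++ t).
Proof.
apply: tcls_eq => P phi b.
by rewrite !tsum_cat -!/(tlift phi _) !tlift_cls.
Qed.

Lemma toppE s : topp (tcls s) = tcls [seq (- z.1, z.2) | z <- s].
Proof.
apply: tcls_eq => P phi b.
by rewrite !tsum_opp // -!/(tlift phi _) !tlift_cls.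
Qed.

Lemma tens_addA : associative tadd.
Proof.
move=> x y z; rewrite -(trepK x) -(trepK y) -(trepK z) !taddE.
by rewrite catA.
Qed.

Lemma tens_addC : commutative tadd.
Proof.
move=> x y; rewrite -(trepK x) -(trepK y) !taddE.
by apply: tcls_eq => P phi b; rewrite !tsum_cat addrC.
Qed.

Lemma tens_add0 : left_id tzero tadd.
Proof. by move=> x; rewrite -(trepK x) taddE. Qed.

Lemma tens_addN : left_inverse tzero topp tadd.
Proof.
move=> x; rewrite -(trepK x) toppE taddE.
apply: tcls_eq => P phi b.
by rewrite tsum_cat tsum_opp // addNr /tsum big_nil.
Qed.

HB.instance Definition _ :=
  GRing.isZmodule.Build tens tens_addA tens_addC tens_add0 tens_addN.

Lemma tlift_pure (P : zmodType) (phi : M -> N -> P) m n :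
  balanced phi -> tlift phi (tpure m n) = phi m n.
Proof. by move=> b; rewrite tlift_cls // /tsum big_seq1. Qed.

Lemma tliftD (P : zmodType) (phi : M -> N -> P) :
  balanced phi -> {morph tlift phi : x y / x + y}.
Proof.
move=> b x y; rewrite -(trepK x) -(trepK y) [_ + _]taddE.
by rewrite !tlift_cls // tsum_cat.
Qed.

Lemma tpure_balanced : balanced tpure.
Proof.
split=> [n x y|m x y|r m n].
- rewrite [RHS]taddE; apply: tcls_eq => P phi [h _ _].
  by rewrite tsum_cat /tsum !big_seq1 h.
- rewrite [RHS]taddE; apply: tcls_eq => P phi [_ h _].
  by rewrite tsum_cat /tsum !big_seq1 h.
- by apply: tcls_eq => P phi [_ _ h]; rewrite /tsum !big_seq1 h.
Qed.

Lemma tens_ind (Q : tens -> Prop) :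
  Q 0 -> (forall x y, Q x -> Q y -> Q (x + y)) ->
  (forall m n, Q (tpure m n)) -> forall x, Q x.
Proof.
move=> h0 hD hp x; rewrite -(trepK x); elim: (trep x) => [|[m n] s IH] //.
have -> : tcls ((m, n) :: s) = tpure m n + tcls s by rewrite [RHS]taddE.
exact: hD.
Qed.

Lemma tens_eq_hom (P : zmodType) (f g : tens -> P) :
  {morph f : x y / x + y} -> {morph g : x y / x + y} ->
  (forall m n, f (tpure m n) = g (tpure m n)) -> f =1 g.
Proof.
move=> hf hg h; apply: tens_ind => [|x y fx fy|//].
- have z (k : tens -> P) : {morph k : x y / x + y} -> k 0 = 0.
    by move=> hk; apply: (addrI (k 0)); rewrite -hk !addr0.
  by rewrite !z.
- by rewrite hf hg fx fy.
Qed.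

End Tensor.

Section TensorRing.
Variables (F : Type) (B C : comPzRingType) (fB : F -> B) (fC : F -> C).

(* B (x)_F C, for the algebra structures given by fB and fC. *)
Definition tring : Type :=
  tens (fun r (b : B) => fB r * b) (fun r (c : C) => fC r * c).
HB.instance Definition _ := GRing.Zmodule.on tring.

Definition tr (b : B) (c : C) : tring := tpure _ _ b c.

Lemma trDl c : {morph tr^~ c : x y / x + y}.
Proof. by case: (tpure_balanced (fun r (b : B) => fB r * b) (fun r (c : C) => fC r * c)). Qed.
Lemma trDr b : {morph tr b : x y / x + y}.
Proof. by case: (tpure_balanced (fun r (b : B) => fB r * b) (fun r (c : C) => fC r * c)). Qed.
Lemma tr_bal r b c : tr (fB r * b) c = tr b (fC r * c).
Proof. by case: (tpure_balanced (fun r (b : B) => fB r * b) (fun r (c : C) => fC r * c)). Qed.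

Definition tmul_in (b : B) (c : C) (y : tring) : tring :=
  tlift (fun b' c' => tr (b * b') (c * c')) y.
Definition tmul (x y : tring) : tring := tlift (fun b c => tmul_in b c y) x.
Definition tone : tring := tr 1 1.

Lemma tmul_in_bal b c :
  balanced (fun r (b : B) => fB r * b) (fun r (c : C) => fC r * c)
    (fun b' c' => tr (b * b') (c * c')).
Proof.
split=> [n x y|m x y|r m n]; first by rewrite mulrDr trDl.
- by rewrite mulrDr trDr.
- by rewrite mulrCA tr_bal mulrCA.
Qed.

Lemma tmul_inE b c b' c' : tmul_in b c (tr b' c') = tr (b * b') (c * c').
Proof. exact/tlift_pure/tmul_in_bal. Qed.

Lemma tmul_inD b c : {morph tmul_in b c : x y / x + y}.
Proof. exact/tliftD/tmul_in_bal. Qed.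

Lemma add_hom_add (V W : zmodType) (f g : V -> W) :
  {morph f : x y / x + y} -> {morph g : x y / x + y} ->
  {morph (fun x => f x + g x) : x y / x + y}.
Proof. by move=> hf hg x y; rewrite hf hg addrACA. Qed.

Lemma tmul_bal y :
  balanced (fun r (b : B) => fB r * b) (fun r (c : C) => fC r * c)
    (fun b c => tmul_in b c y).
Proof.
split=> [n b b'|m c c'|r m n].
- move: y; apply: tens_eq_hom; [exact: tmul_inD| |].
    by apply: add_hom_add; exact: tmul_inD.
  by move=> b0 c0; rewrite -[tpure _ _ _ _]/(tr b0 c0) !tmul_inE mulrDl trDl.
- move: y; apply: tens_eq_hom; [exact: tmul_inD| |].
    by apply: add_hom_add; exact: tmul_inD.
  by move=> b0 c0; rewrite -[tpure _ _ _ _]/(tr b0 c0) !tmul_inE mulrDl trDr.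
- move: y; apply: tens_eq_hom; try exact: tmul_inD.
  move=> b0 c0; rewrite -[tpure _ _ _ _]/(tr b0 c0) !tmul_inE.
  by rewrite -!mulrA tr_bal.
Qed.

Lemma tmulDl y : {morph tmul^~ y : x x' / x + x'}.
Proof. exact/tliftD/tmul_bal. Qed.

Lemma tmul_pl b c y : tmul (tr b c) y = tmul_in b c y.
Proof. by rewrite /tmul /tr (tlift_pure _ _ (tmul_bal y)). Qed.

Lemma tmul_trE b c b' c' : tmul (tr b c) (tr b' c') = tr (b * b') (c * c').
Proof. by rewrite tmul_pl tmul_inE. Qed.

Lemma tring_eq_hom (P : zmodType) (f g : tring -> P) :
  {morph f : x y / x + y} -> {morph g : x y / x + y} ->
  (forall b c, f (tr b c) = g (tr b c)) -> f =1 g.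
Proof. exact: tens_eq_hom. Qed.

Lemma tmulC : commutative tmul.
Proof.
have D2 x : {morph tmul x : y y' / y + y'}.
  move=> y y'; move: x; apply: tring_eq_hom; try exact: tmulDl.
    by apply: add_hom_add; exact: tmulDl.
  by move=> b c; rewrite !tmul_pl tmul_inD.
move=> x y; move: x; apply: tring_eq_hom; [exact: tmulDl|exact: D2|].
move=> b c; move: y; apply: tring_eq_hom; [exact: D2|exact: tmulDl|].
by move=> b' c'; rewrite !tmul_trE mulrC [c * c']mulrC.
Qed.

Lemma tmulDr x : {morph tmul x : y y' / y + y'}.
Proof. by move=> y y'; rewrite ![tmul x _]tmulC tmulDl. Qed.

Lemma tmulA : associative tmul.
Proof.
move=> x y z; move: x; apply: tring_eq_hom.
- exact: tmulDl.
- by move=> x x'; rewrite !tmulDl.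
move=> b c; move: y; apply: tring_eq_hom.
- by move=> y y'; rewrite tmulDl tmulDr.
- by move=> y y'; rewrite tmulDr tmulDl.
move=> b' c'; move: z; apply: tring_eq_hom.
- by move=> z z'; rewrite !tmulDr.
- by move=> z z'; rewrite tmulDr.
by move=> b'' c''; rewrite !tmul_trE !mulrA.
Qed.

Lemma tmul1 : left_id tone tmul.
Proof.
apply: tring_eq_hom => [| //|b c]; first exact: tmulDr.
by rewrite tmul_trE !mul1r.
Qed.

HB.instance Definition _ :=
  GRing.Zmodule_isComPzRing.Build tring tmulA tmulC tmul1 (fun x y z => tmulDl z x y).

Lemma trM b c b' c' : tr b c * tr b' c' = tr (b * b') (c * c').
Proof. exact: tmul_trE. Qed.

End TensorRing.
Arguments tr {F B C} fB fC b c.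

Section TensorRingMap.
Variables (F : Type) (B C D : comPzRingType).
Variables (fB : F -> B) (fC : F -> C) (fD : F -> D).
Variables (g : {rmorphism C -> D}) (gF : forall r, g (fC r) = fD r).

Definition tring_map of (forall r, g (fC r) = fD r) :=
  fun x : tring fB fC => tlift (fun b c => tr fB fD b (g c)) x : tring fB fD.

Lemma tring_map_bal :
  balanced (fun r (b : B) => fB r * b) (fun r (c : C) => fC r * c)
    (fun b c => tr fB fD b (g c)).
Proof.
split=> [n x y|m x y|r m n]; first by rewrite trDl.
- by rewrite rmorphD trDr.
- by rewrite tr_bal rmorphM gF.
Qed.

Lemma tring_mapE b c : tring_map gF (tr fB fC b c) = tr fB fD b (g c).
Proof. exact: (tlift_pure _ _ tring_map_bal). Qed.

Lemma tring_mapD : {morph tring_map gF : x y / x + y}.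
Proof. exact: (tliftD tring_map_bal). Qed.

Lemma tring_map_nmod : nmod_morphism (tring_map gF).
Proof.
split; last exact: tring_mapD.
by apply: (addrI (tring_map gF 0)); rewrite -tring_mapD !addr0.
Qed.

Lemma tring_map_monoid : monoid_morphism (tring_map gF).
Proof.
split; first by rewrite tring_mapE rmorph1.
move=> x y; move: x; apply: tring_eq_hom.
- by move=> x x'; rewrite mulrDl tring_mapD.
- by move=> x x'; rewrite tring_mapD mulrDl.
move=> b c; move: y; apply: tring_eq_hom.
- by move=> y y'; rewrite mulrDr tring_mapD.
- by move=> y y'; rewrite tring_mapD mulrDr.
by move=> b' c'; rewrite trM !tring_mapE trM rmorphM.
Qed.

HB.instance Definition _ :=
  GRing.isNmodMorphism.Build _ _ (tring_map gF) tring_map_nmod.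
HB.instance Definition _ :=
  GRing.isMonoidMorphism.Build _ _ (tring_map gF) tring_map_monoid.

End TensorRingMap.

Section BaseChange.
Variables (R S : comPzRingType) (f : R -> S) (M : lmodType R).

(* M (x)_R S, an S-module through the second factor. *)
Definition base_change : Type :=
  tens (fun r (m : M) => r *: m) (fun r (s : S) => f r * s).
HB.instance Definition _ := GRing.Zmodule.on base_change.

Definition bc (m : M) (s : S) : base_change := tpure _ _ m s.

Let bal := tpure_balanced (fun r (m : M) => r *: m) (fun r (s : S) => f r * s).
Lemma bcDl s : {morph bc^~ s : x y / x + y}. Proof. by case: bal. Qed.
Lemma bcDr m : {morph bc m : x y / x + y}. Proof. by case: bal. Qed.
Lemma bc_bal r m s : bc (r *: m) s = bc m (f r * s). Proof. by case: bal. Qed.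

Definition bc_scale (c : S) (x : base_change) : base_change :=
  tlift (fun m s => bc m (c * s)) x.

Lemma bc_scale_bal c :
  balanced (fun r (m : M) => r *: m) (fun r (s : S) => f r * s)
    (fun m s => bc m (c * s)).
Proof.
split=> [n x y|m x y|r m n]; first by rewrite bcDl.
- by rewrite mulrDr bcDr.
- by rewrite bc_bal mulrCA.
Qed.

Lemma bc_scaleE c m s : bc_scale c (bc m s) = bc m (c * s).
Proof. exact: (tlift_pure _ _ (bc_scale_bal c)). Qed.

Lemma bc_scaleDr : right_distributive bc_scale +%R.
Proof. by move=> c; exact: (tliftD (bc_scale_bal c)). Qed.

Lemma bc_eq_hom (P : zmodType) (h k : base_change -> P) :
  {morph h : x y / x + y} -> {morph k : x y / x + y} ->
  (forall m s, h (bc m s) = k (bc m s)) -> h =1 k.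
Proof. exact: tens_eq_hom. Qed.

Lemma bc_scaleA a b x : bc_scale a (bc_scale b x) = bc_scale (a * b) x.
Proof.
move: x; apply: bc_eq_hom; last by move=> m s; rewrite !bc_scaleE mulrA.
- by move=> x y; rewrite !bc_scaleDr.
- by move=> x y; rewrite !bc_scaleDr.
Qed.

Lemma bc_scale1 : left_id 1 bc_scale.
Proof.
apply: bc_eq_hom => [||m s //]; [exact: bc_scaleDr|by []|].
by rewrite bc_scaleE mul1r.
Qed.

Lemma bc_scaleDl x : {morph bc_scale^~ x : a b / a + b}.
Proof.
move=> a b; move: x; apply: bc_eq_hom.
- exact: bc_scaleDr.
- by apply: add_hom_add; exact: bc_scaleDr.
by move=> m s; rewrite !bc_scaleE mulrDl bcDr.
Qed.

HB.instance Definition _ := GRing.Zmodule_isLmodule.Build S base_change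
  bc_scaleA bc_scale1 bc_scaleDr bc_scaleDl.

Lemma bcZ c m s : c *: bc m s = bc m (c * s).
Proof. exact: bc_scaleE. Qed.

End BaseChange.
Arguments bc {R S} f {M} m s.

Section BaseChangeMap.
Variables (R S : comPzRingType) (f : R -> S) (M N : lmodType R).
Variable (h : {linear M -> N}).

Definition bc_map (x : base_change f M) : base_change f N :=
  tlift (fun m s => bc f (h m) s) x.

Lemma bc_map_bal :
  balanced (fun r (m : M) => r *: m) (fun r (s : S) => f r * s)
    (fun m s => bc f (h m) s).
Proof.
split=> [n x y|m x y|r m n]; first by rewrite linearD bcDl.
- by rewrite bcDr.
- by rewrite linearZ bc_bal.
Qed.

Lemma bc_mapE m s : bc_map (bc f m s) = bc f (h m) s.
Proof. exact: (tlift_pure _ _ bc_map_bal). Qed.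

Lemma bc_mapD : {morph bc_map : x y / x + y}.
Proof. exact: (tliftD bc_map_bal). Qed.

Lemma bc_map_linear : linear bc_map.
Proof.
move=> c x y; rewrite bc_mapD; congr (_ + _).
move: x; apply: bc_eq_hom; last by move=> m s; rewrite bcZ !bc_mapE bcZ.
- by move=> u v; rewrite scalerDr bc_mapD.
- by move=> u v; rewrite bc_mapD scalerDr.
Qed.

HB.instance Definition _ :=
  GRing.isLinear.Build S (base_change f M) (base_change f N) *:%R bc_map bc_map_linear.

End BaseChangeMap.
Arguments bc_map {R S} f {M N} h x.

(* The additive subgroup generated by the products d *: g; for a subring D of R
   this is the D-submodule generated by G. *)
Definition span (R : pzRingType) (V : lmodType R) (D : set R) (G : set V) : set V :=
  [set x | exists s : seq (R * V),
     (forall z, z \in s -> D z.1 /\ G z.2) /\ x = \sum_(z <- s) z.1 *: z.2].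

Definition ideal_gen (R : pzRingType) (D G : set R) : set R :=
  @span R R^o D G.

(* J ^ n, for an ideal J of the subring D of R *)
Definition ideal_pow (R : comPzRingType) (D J : set R) (n : nat) : set R :=
  ideal_gen D [set x | exists2 a : 'I_n -> R, (forall i, J (a i)) & x = \prod_i a i].

Section SpanTheory.
Variables (R : comPzRingType) (V : lmodType R).

Lemma span0 (D : set R) (G : set V) : span D G 0.
Proof. by exists [::]; split=> //; rewrite big_nil. Qed.

Lemma spanD (D : set R) (G : set V) x y :
  span D G x -> span D G y -> span D G (x + y).
Proof.
move=> [s [hs ->]] [t [ht ->]]; exists (s ++ t); split; last by rewrite big_cat.
by move=> z; rewrite mem_cat => /orP[/hs|/ht].
Qed.

Lemma spanZ (G : set V) a x : span setT G x -> span setT G (a *: x).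
Proof.
move=> [s [hs ->]]; exists [seq (a * z.1, z.2) | z <- s]; split.
  by move=> z /mapP[w /hs[_ h] ->].
by rewrite big_map scaler_sumr; apply: eq_bigr => z _; rewrite scalerA.
Qed.

Lemma span_gen (G : set V) x : G x -> span setT G x.
Proof.
move=> h; exists [:: (1, x)]; split; last by rewrite big_seq1 scale1r.
by move=> z; rewrite inE => /eqP ->.
Qed.

Lemma span_min (G H : set V) : H 0 -> (forall x y, H x -> H y -> H (x + y)) ->
  (forall a x, H x -> H (a *: x)) -> (forall x, G x -> H x) ->
  forall x, span setT G x -> H x.
Proof.
move=> h0 hD hZ hG x [s [hs ->]]; rewrite big_seq.
by apply: big_ind => // z /hs[_ /hG]; exact: hZ.
Qed.

End SpanTheory.

Section IdealPow.
Variables (R : comPzRingType) (J : set R).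
Local Notation pow := (ideal_pow setT J).

Lemma pow0 n : pow n 0. Proof. exact: span0. Qed.
Lemma powD n x y : pow n x -> pow n y -> pow n (x + y). Proof. exact: spanD. Qed.
Lemma powM n a x : pow n x -> pow n (a * x). Proof. exact: (@spanZ R R^o). Qed.
Lemma powN n x : pow n x -> pow n (- x).
Proof. by move=> h; rewrite -mulN1r; exact: powM. Qed.

Lemma pow_le m n : (m <= n)%N -> forall x, pow n x -> pow m x.
Proof.
move=> /subnKC <-; set k := (n - m)%N; apply: (@span_min R R^o).
- exact: pow0.
- exact: powD.
- exact: powM.
move=> x [a ha ->]; rewrite big_split_ord /= mulrC; apply: powM.
apply: span_gen; exists (fun i => a (lshift k i)) => // i; exact: ha.
Qed.

Lemma pow_add_ind m n (H : R -> Prop) : H 0 ->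
  (forall x y, pow (m + n) x -> pow (m + n) y -> H x -> H y -> H (x + y)) ->
  (forall x y, pow m x -> pow n y -> H (x * y)) ->
  forall x, pow (m + n) x -> H x.
Proof.
move=> h0 hD hM x px.
suff : pow (m + n) x /\ H x by case.
case: px => s [hs ->]; rewrite big_seq.
apply: (big_ind (fun x => pow (m + n) x /\ H x)) => //.
- by split=> //; exact: pow0.
- by move=> u v [pu hu] [pv hv]; split; [exact: powD|exact: hD].
move=> [r y] /hs[_ hy]; split; first by apply: powM; exact: (@span_gen R R^o).
case: hy => [a ha /= ->]; suff h : H (r * \prod_i a i) by [].
rewrite big_split_ord mulrA.
apply: hM.
  apply: powM; apply: span_gen; exists (fun i => a (lshift n i)) => // i; exact: ha.
apply: span_gen; exists (fun i => a (rshift m i)) => // i; exact: ha.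
Qed.

Lemma pow_mul m n x y : pow m x -> pow n y -> pow (m + n) (x * y).
Proof.
move=> hx hy; move: x hx; apply: (@span_min R R^o).
- by rewrite mul0r; exact: pow0.
- by move=> u v hu hv; rewrite mulrDl; exact: powD.
- by move=> a u hu; rewrite -[a *: u]/(a * u) -mulrA; exact: powM.
move=> x [a ha ->]; move: y hy; apply: (@span_min R R^o).
- by rewrite mulr0; exact: pow0.
- by move=> u v hu hv; rewrite mulrDr; exact: powD.
- by move=> b u hu; rewrite -[b *: u]/(b * u) mulrCA; exact: powM.
move=> y [b hb ->]; apply: span_gen.
exists (fun i => match split i with inl j => a j | inr j => b j end).
  by move=> i; case: (split i) => j; [exact: ha|exact: hb].
rewrite big_split_ord /=; congr (_ * _); apply: eq_bigr => i _.
  by rewrite (unsplitK (inl i)).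
by rewrite (unsplitK (inr i)).
Qed.

End IdealPow.

Section Germ.
Variables (R : comPzRingType) (J : set R) (M : lmodType R).
Local Notation pow := (ideal_pow setT J).

(* An R-linear map J ^ gexp -> M; the values of gfun off J ^ gexp are junk. *)
Record pregerm := PreGerm {
  gexp : nat;
  gfun : R -> M;
  gfunP : forall a x y, pow gexp x -> pow gexp y ->
    gfun (a * x + y) = a *: gfun x + gfun y }.

HB.instance Definition _ := gen_eqMixin pregerm.
HB.instance Definition _ := gen_choiceMixin pregerm.

Definition germ_eq (g h : pregerm) : bool :=
  `[< exists n, forall x, pow n x -> gfun g x = gfun h x >].

Lemma germ_eq_refl : reflexive germ_eq.
Proof. by move=> g; apply/asboolP; exists 0%N. Qed.

Lemma germ_eq_sym : symmetric germ_eq.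
Proof.
by move=> g h; apply/asboolP/asboolP => -[n e]; exists n => x hx; rewrite e.
Qed.

Lemma germ_eq_trans : transitive germ_eq.
Proof.
move=> h g k /asboolP[n e] /asboolP[m e']; apply/asboolP.
exists (maxn n m) => x hx; rewrite e ?e' //.
  by apply: pow_le hx; rewrite leq_maxr.
by apply: pow_le hx; rewrite leq_maxl.
Qed.

Canonical germ_eq_equiv := EquivRel germ_eq germ_eq_refl germ_eq_sym germ_eq_trans.

(* M[J^-1] := colim_n Hom_R (J ^ n, M): the sections of M over Spec R \ V(J).
   When J is invertible, Hom_R (J ^ n, M) is J ^ (-n) M. *)
Definition germ : Type := {eq_quot germ_eq}.
HB.instance Definition _ := Choice.on germ.

Definition gcls (g : pregerm) : germ := \pi_{eq_quot germ_eq} g.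
Definition grep (x : germ) : pregerm := repr (x : {eq_quot germ_eq}).

Lemma grepK x : gcls (grep x) = x. Proof. exact: reprK. Qed.

Lemma gcls_eq g h :
  (exists n, forall x, pow n x -> gfun g x = gfun h x) -> gcls g = gcls h.
Proof. by move=> e; apply/eqmodP/asboolP. Qed.

Lemma grep_cls g : exists n, forall x, pow n x -> gfun (grep (gcls g)) x = gfun g x.
Proof.
have /eqmodP /asboolP // : gcls (grep (gcls g)) = gcls g by rewrite grepK.
Qed.

Lemma gfun_lin (g : pregerm) n a x y : (gexp g <= n)%N -> pow n x -> pow n y ->
  gfun g (a * x + y) = a *: gfun g x + gfun g y.
Proof. by move=> le hx hy; apply: gfunP; exact: pow_le le _ _. Qed.

Lemma pgaddP (g h : pregerm) a x y :
  pow (maxn (gexp g) (gexp h)) x -> pow (maxn (gexp g) (gexp h)) y ->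
  gfun g (a * x + y) + gfun h (a * x + y) =
  a *: (gfun g x + gfun h x) + (gfun g y + gfun h y).
Proof.
move=> hx hy; rewrite (gfun_lin _ _ hx hy) ?leq_maxl //.
by rewrite (gfun_lin _ _ hx hy) ?leq_maxr // scalerDr addrACA.
Qed.
Definition pgadd g h := PreGerm (@pgaddP g h).

Lemma pgscaleP c (g : pregerm) a x y : pow (gexp g) x -> pow (gexp g) y ->
  c *: gfun g (a * x + y) = a *: (c *: gfun g x) + c *: gfun g y.
Proof. by move=> hx hy; rewrite gfunP // scalerDr !scalerA mulrC. Qed.
Definition pgscale c g := PreGerm (@pgscaleP c g).

Lemma plocP (m : M) a x y : pow 0 x -> pow 0 y ->
  (a * x + y) *: m = a *: (x *: m) + y *: m.
Proof. by move=> _ _; rewrite scalerDl scalerA. Qed.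
Definition ploc m := PreGerm (@plocP m).

Definition gadd (x y : germ) := gcls (pgadd (grep x) (grep y)).
Definition gscale c (x : germ) := gcls (pgscale c (grep x)).
Definition loc (m : M) : germ := gcls (ploc m).

Lemma gaddE g h : gadd (gcls g) (gcls h) = gcls (pgadd g h).
Proof.
case: (grep_cls g) => n e; case: (grep_cls h) => m e'.
apply: gcls_eq; exists (maxn n m) => x hx /=; rewrite e ?e' //.
  by apply: pow_le hx; rewrite leq_maxr.
by apply: pow_le hx; rewrite leq_maxl.
Qed.

Lemma gscaleE c g : gscale c (gcls g) = gcls (pgscale c g).
Proof.
case: (grep_cls g) => n e.
by apply: gcls_eq; exists n => x hx /=; rewrite e.
Qed.

Ltac gext := apply: gcls_eq; exists 0%N => ? _ /=.

Lemma gaddA : associative gadd.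
Proof.
move=> x y z; rewrite -(grepK x) -(grepK y) -(grepK z) !gaddE.
by gext; rewrite addrA.
Qed.
Lemma gaddC : commutative gadd.
Proof.
by move=> x y; rewrite -(grepK x) -(grepK y) !gaddE; gext; rewrite addrC.
Qed.
Lemma gadd0 : left_id (loc 0) gadd.
Proof.
by move=> x; rewrite -(grepK x) gaddE; gext; rewrite scaler0 add0r.
Qed.
Lemma gaddN : left_inverse (loc 0) (gscale (-1)) gadd.
Proof.
move=> x; rewrite -(grepK x) gscaleE gaddE; gext.
by rewrite scaler0 scaleN1r addNr.
Qed.
HB.instance Definition _ := GRing.isZmodule.Build germ gaddA gaddC gadd0 gaddN.

Lemma gscaleA a b x : gscale a (gscale b x) = gscale (a * b) x.
Proof. by rewrite -(grepK x) !gscaleE; gext; rewrite scalerA. Qed.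
Lemma gscale1 : left_id 1 gscale.
Proof. by move=> x; rewrite -(grepK x) gscaleE; gext; rewrite scale1r. Qed.
Lemma gscaleDr : right_distributive gscale +%R.
Proof.
move=> c x y; rewrite -(grepK x) -(grepK y).
have E u v : gcls u + gcls v = gcls (pgadd u v) := gaddE u v.
by rewrite E !gscaleE E; gext; rewrite scalerDr.
Qed.
Lemma gscaleDl x : {morph gscale^~ x : a b / a + b}.
Proof.
move=> a b; rewrite -(grepK x) !gscaleE [RHS]gaddE; gext.
by rewrite scalerDl.
Qed.
HB.instance Definition _ := GRing.Zmodule_isLmodule.Build R germ
  gscaleA gscale1 gscaleDr gscaleDl.

Lemma gaddE' g h : gcls g + gcls h = gcls (pgadd g h). Proof. exact: gaddE. Qed.
Lemma gscaleE' c g : c *: gcls g = gcls (pgscale c g). Proof. exact: gscaleE. Qed.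

Lemma loc_linear : linear loc.
Proof.
move=> a x y; rewrite gscaleE' gaddE'; gext.
by rewrite scalerDr !scalerA mulrC.
Qed.
HB.instance Definition _ := GRing.isLinear.Build R M germ *:%R loc loc_linear.

End Germ.
Arguments loc {R} J {M} m.

Section GermMap.
Variables (R : comPzRingType) (J : set R) (M N : lmodType R).
Variable (h : {linear M -> N}).
Local Notation pow := (ideal_pow setT J).

Lemma pgmapP (g : pregerm J M) a x y : pow (gexp g) x -> pow (gexp g) y ->
  h (gfun g (a * x + y)) = a *: h (gfun g x) + h (gfun g y).
Proof. by move=> hx hy; rewrite gfunP // linearP. Qed.
Definition pgmap g := PreGerm (@pgmapP g).

Definition germ_map (x : germ J M) : germ J N := gcls (pgmap (grep x)).

Lemma germ_mapE g : germ_map (gcls g) = gcls (pgmap g).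
Proof.
case: (grep_cls g) => n e.
by apply: gcls_eq; exists n => x hx /=; rewrite e.
Qed.

Lemma germ_map_linear : linear germ_map.
Proof.
move=> c x y; rewrite -(grepK x) -(grepK y) gscaleE' gaddE' !germ_mapE.
rewrite gscaleE' gaddE'; apply: gcls_eq; exists 0%N => z _ /=.
by rewrite linearP.
Qed.
HB.instance Definition _ :=
  GRing.isLinear.Build R (germ J M) (germ J N) *:%R germ_map germ_map_linear.

Lemma germ_map_loc m : germ_map (loc J m) = loc J (h m).
Proof.
rewrite germ_mapE; apply: gcls_eq; exists 0%N => z _ /=.
by rewrite linearZ.
Qed.

End GermMap.
Arguments germ_map {R} J {M N} h x.

Section GermMul.
Variables (R : comPzRingType) (J : set R) (M : lmodType R).
Local Notation pow := (ideal_pow setT J).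

Lemma pregerm0 (N : lmodType R) (g : pregerm J N) : gfun g 0 = 0.
Proof.
have h0 := pow0 J (gexp g).
have := gfunP (-1) h0 h0.
by rewrite mulr0 addr0 scaleN1r addNr.
Qed.

Lemma pregermD (N : lmodType R) (g : pregerm J N) x y :
  pow (gexp g) x -> pow (gexp g) y -> gfun g (x + y) = gfun g x + gfun g y.
Proof. by move=> hx hy; have := gfunP 1 hx hy; rewrite mul1r scale1r. Qed.

Lemma pregermZ (N : lmodType R) (g : pregerm J N) a x :
  pow (gexp g) x -> gfun g (a * x) = a *: gfun g x.
Proof.
move=> hx; have := gfunP a hx (pow0 J (gexp g)).
by rewrite !addr0 pregerm0 addr0.
Qed.

Lemma pregerm_pow (g : pregerm J R^o) n x :
  pow (gexp g + n) x -> pow n (gfun g x).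
Proof.
move: x; apply: pow_add_ind => [|x y hx hy gx gy|x y hx hy].
- by rewrite pregerm0; exact: pow0.
- have le := pow_le (leq_addr n (gexp g)).
  by rewrite pregermD; [exact: powD|exact: le|exact: le].
- by rewrite mulrC pregermZ // -[_ *: _]/(y * _) mulrC; exact: powM.
Qed.

Lemma pgmulP (g : pregerm J R^o) (h : pregerm J M) a x y :
  pow (gexp g + gexp h) x -> pow (gexp g + gexp h) y ->
  gfun h (gfun g (a * x + y)) = a *: gfun h (gfun g x) + gfun h (gfun g y).
Proof.
move=> hx hy; rewrite (gfun_lin _ _ hx hy) ?leq_addr //.
by apply: gfunP; exact: pregerm_pow.
Qed.
Definition pgmul g h := PreGerm (@pgmulP g h).

(* The action of R[J^-1] on M[J^-1]: a linear x : J^k -> R maps J^(k+n) into J^n,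
   and x * m is the composite J^(k+n) -> J^n -> M if m is defined on J^n. *)
Definition gmul (x : germ J R^o) (m : germ J M) : germ J M :=
  gcls (pgmul (grep x) (grep m)).

Lemma gmulE g h : gmul (gcls g) (gcls h) = gcls (pgmul g h).
Proof.
case: (grep_cls g) => n e; case: (grep_cls h) => m e'.
apply: gcls_eq; exists (maxn n (gexp g + m)) => x hx /=; rewrite e.
  rewrite e' //; apply: pregerm_pow; by apply: pow_le hx; rewrite leq_maxr.
by apply: pow_le hx; rewrite leq_maxl.
Qed.

Lemma gmul_linear (m : germ J M) a (x y : germ J R^o) :
  gmul (a *: x + y) m = a *: gmul x m + gmul y m.
Proof.
rewrite -(grepK x) -(grepK y) -(grepK m).
set g := grep x; set h := grep y; set k := grep m.
rewrite gscaleE' gaddE' !gmulE gscaleE' gaddE'.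
apply: gcls_eq; exists (maxn (gexp g) (gexp h) + gexp k)%N => z hz /=.
by rewrite gfunP //; apply: pregerm_pow; apply: pow_le hz; rewrite leq_add2r ?leq_maxl ?leq_maxr.
Qed.

Lemma gmul1 m : gmul (loc J (1 : R^o)) m = m.
Proof.
rewrite -(grepK m) gmulE; apply: gcls_eq; exists 0%N => z _ /=.
by rewrite [_ *: _]mulr1.
Qed.

End GermMul.

Section GermFunctor.
Variables (R : comPzRingType) (J : set R).

Lemma germ_map_comp (M N P : lmodType R) (g : {linear N -> P}) (h : {linear M -> N})
    (k : {linear M -> P}) x :
  (forall m, k m = g (h m)) -> germ_map J k x = germ_map J g (germ_map J h x).
Proof.
move=> e; rewrite -(grepK x) !germ_mapE.
by apply: gcls_eq; exists 0%N => z _ /=; rewrite e.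
Qed.

Lemma germ_map_id (M : lmodType R) (k : {linear M -> M}) x :
  (forall m, k m = m) -> germ_map J k x = x.
Proof.
move=> e; rewrite -(grepK x) germ_mapE.
by apply: gcls_eq; exists 0%N => z _ /=; rewrite e.
Qed.

Lemma germ_map_add (M N : lmodType R) (h k l : {linear M -> N}) x :
  (forall m, l m = h m + k m) -> germ_map J l x = germ_map J h x + germ_map J k x.
Proof.
move=> e; rewrite -(grepK x) !germ_mapE gaddE'.
by apply: gcls_eq; exists 0%N => z _ /=; rewrite e.
Qed.

Lemma germ_map_zero (M N : lmodType R) (k : {linear M -> N}) x :
  (forall m, k m = 0) -> germ_map J k x = 0.
Proof.
move=> e; rewrite -(grepK x) germ_mapE [RHS](_ : _ = loc J 0) ?linear0 //.
by apply: gcls_eq; exists 0%N => z _ /=; rewrite e scaler0.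
Qed.

End GermFunctor.

Section DirectSum.
Variables (R : pzRingType) (M N : lmodType R).

Definition pinl (m : M) : (M * N)%type := (m, 0).
Definition pinr (n : N) : (M * N)%type := (0, n).

Lemma pinl_linear : linear pinl.
Proof.
move=> a x y; rewrite /pinl.
by apply: (congr2 pair) => //=; rewrite scaler0 addr0.
Qed.
Lemma pinr_linear : linear pinr.
Proof.
move=> a x y; rewrite /pinr.
by apply: (congr2 pair) => //=; rewrite scaler0 addr0.
Qed.
HB.instance Definition _ := GRing.isLinear.Build R M (M * N)%type *:%R pinl pinl_linear.
HB.instance Definition _ := GRing.isLinear.Build R N (M * N)%type *:%R pinr pinr_linear.

End DirectSum.
Arguments pinl {R M} N m.
Arguments pinr {R} M {N} n.

(* Zariski-locally free of rank r: Spec R is covered by the D(f), f in s, and the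
   images of e 0, ..., e (r - 1) form a basis of M[1/f] over R[1/f]. *)
Definition locally_free (R : comPzRingType) (M : lmodType R) (r : nat) : Prop :=
  exists s : seq R, ideal_gen setT [set f | f \in s] 1 /\
  forall f, f \in s -> exists e : 'I_r -> M,
    (forall m, exists k (c : 'I_r -> R), f ^+ k *: m = \sum_i c i *: e i) /\
    (forall c : 'I_r -> R, \sum_i c i *: e i = 0 ->
       exists k, forall i, f ^+ k * c i = 0).

Section Motive.
Variables (R : comPzRingType) (tau : {rmorphism R -> R}) (J : set R).

Local Notation twist := (base_change tau).

Record motive := Motive {
  mmod :> lmodType R;
  mtau : {linear germ J (twist mmod) -> germ J mmod};
  motive_lf : exists r, locally_free mmod r;
  motive_iso : bijective mtau }.

Definition is_motive_map (M N : motive) (h : {linear M -> N}) : Prop :=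
  forall x, germ_map J h (mtau M x) = mtau N (germ_map J (bc_map tau h) x).

Definition twist1 (x : base_change tau R^o) : R^o :=
  tlift (fun (r : R^o) (s : R) => tau r * s : R^o) x.

Lemma twist1_bal :
  balanced (fun r (m : R^o) => r *: m) (fun r (s : R) => tau r * s)
    (fun (r : R^o) (s : R) => tau r * s : R^o).
Proof.
split=> [n x y|m x y|r m n]; first by rewrite rmorphD mulrDl.
- by rewrite mulrDr.
- by rewrite rmorphM -mulrA mulrCA.
Qed.

Lemma twist1E r s : twist1 (bc tau (r : R^o) s) = tau r * s.
Proof. exact: (tlift_pure _ _ twist1_bal). Qed.

Lemma twist1D : {morph twist1 : x y / x + y}.
Proof. exact: (tliftD twist1_bal). Qed.

Lemma twist1_linear : linear twist1.
Proof.
move=> c x y; rewrite twist1D; congr (_ + _).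
move: x; apply: bc_eq_hom.
- by move=> u v; rewrite scalerDr twist1D.
- by move=> u v; rewrite twist1D scalerDr.
by move=> m s; rewrite bcZ !twist1E mulrCA.
Qed.
HB.instance Definition _ :=
  GRing.isLinear.Build R (base_change tau R^o) R^o *:%R twist1 twist1_linear.

Definition untwist1 (s : R^o) : base_change tau R^o := bc tau (1 : R^o) s.
Lemma untwist1_linear : linear untwist1.
Proof. by move=> c x y; rewrite /untwist1 bcZ bcDr. Qed.
HB.instance Definition _ :=
  GRing.isLinear.Build R R^o (base_change tau R^o) *:%R untwist1 untwist1_linear.

Lemma twist1K : cancel twist1 untwist1.
Proof.
apply: bc_eq_hom => [x y|//|m s]; first by rewrite twist1D linearD.
rewrite twist1E /untwist1 -(bc_bal tau m (1 : R^o) s).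
by rewrite [_ *: _]mulr1.
Qed.
Lemma untwist1K : cancel untwist1 twist1.
Proof. by move=> s; rewrite twist1E rmorph1 mul1r. Qed.

Definition unit_tau : {linear germ J (twist R^o) -> germ J R^o} := germ_map J twist1.

Lemma unit_tau_bij : bijective unit_tau.
Proof.
exists (germ_map J untwist1) => x.
  rewrite /unit_tau /= -(@germ_map_comp _ _ _ _ _ _ _ idfun); last first.
    by move=> m; rewrite /= twist1K.
  exact: germ_map_id.
rewrite /unit_tau /= -(@germ_map_comp _ _ _ _ _ _ _ idfun); last first.
  by move=> m; rewrite /= untwist1K.
exact: germ_map_id.
Qed.

Lemma unit_lf : exists r, locally_free (R^o : lmodType R) r.
Proof.
exists 1%N, [:: 1]; split.
  by apply: span_gen; rewrite /= inE.
move=> f _; exists (fun _ => 1); split=> [m|c].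
  exists 0%N, (fun _ => m); rewrite big_ord1 expr0 scale1r.
  by rewrite [_ *: _]mulr1.
rewrite big_ord1 [_ *: _]mulr1 => e; exists 0%N => i.
by rewrite [i]ord1 e mulr0.
Qed.

Definition unit_motive : motive := Motive unit_lf unit_tau_bij.

Section Extension.
Variable M : motive.

Record extension := Extension {
  emot :> motive;
  einc : {linear M -> emot};
  eproj : {linear emot -> unit_motive};
  einc_map : is_motive_map einc;
  eproj_map : is_motive_map eproj;
  einc_inj : injective einc;
  eproj_surj : forall r, exists x, eproj x = r;
  eexact : forall x, eproj x = 0 <-> exists m, x = einc m }.

Definition ext_equiv (E E' : extension) : Prop :=
  exists (g : {linear E -> E'}) (g' : {linear E' -> E}),
    [/\ is_motive_map g, is_motive_map g', cancel g g', cancel g' g &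
        (forall m, g (einc E m) = einc E' m) /\
        (forall x, eproj E' (g x) = eproj E x)].

Lemma motive_map_id (N : motive) : is_motive_map (idfun : {linear N -> N}).
Proof.
move=> x; rewrite germ_map_id //; congr (mtau _ _).
rewrite germ_map_id // => m; move: m; apply: bc_eq_hom => //.
  exact: linearD.
by move=> m s; exact: bc_mapE.
Qed.

Lemma motive_map_comp (N P Q : motive) (g : {linear P -> Q}) (h : {linear N -> P}) :
  is_motive_map g -> is_motive_map h -> is_motive_map (g \o h : {linear N -> Q}).
Proof.
move=> hg hh x; rewrite (@germ_map_comp _ _ _ _ _ g h) // hh hg.
congr (mtau _ _); apply/esym/germ_map_comp => m; move: m; apply: bc_eq_hom.
- exact: linearD.
- by move=> u v; rewrite !linearD.
by move=> m s; rewrite /= !bc_mapE.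
Qed.

Lemma ext_equiv_refl E : ext_equiv E E.
Proof.
by exists idfun, idfun; split=> //; exact: motive_map_id.
Qed.

Lemma ext_equiv_sym E E' : ext_equiv E E' -> ext_equiv E' E.
Proof.
move=> [g [g' [mg mg' gK g'K [gi gp]]]]; exists g', g; split=> //; split.
  by move=> m; rewrite -gi gK.
by move=> x; rewrite -gp g'K.
Qed.

Lemma ext_equiv_trans E1 E2 E3 :
  ext_equiv E1 E2 -> ext_equiv E2 E3 -> ext_equiv E1 E3.
Proof.
move=> [g [g' [mg mg' gK g'K [gi gp]]]] [h [h' [mh mh' hK h'K [hi hp]]]].
exists (h \o g), (g' \o h'); split; try exact: motive_map_comp.
- by move=> x /=; rewrite hK gK.
- by move=> x /=; rewrite g'K h'K.
- by split=> [m|x] /=; rewrite ?gi ?hi ?hp ?gp.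
Qed.

(* Ext^1(1, M): the equivalence classes of extensions of 1 by M *)
Record Ext1 := MkExt1 {
  ext_class : extension -> Prop;
  ext_classP : exists E, forall E', ext_class E' <-> ext_equiv E E' }.

Lemma cls_ext_proof (E : extension) :
  exists E0, forall E', ext_equiv E E' <-> ext_equiv E0 E'.
Proof. by exists E. Qed.

Definition cls_ext (E : extension) : Ext1 := MkExt1 (cls_ext_proof E).

Section Iota.
Variable m : germ J M.

Definition iota_mod : lmodType R := (M * R^o)%type.

Let inlM : {linear M -> iota_mod} := pinl R^o.
Let inrM : {linear R^o -> iota_mod} := pinr M.
Let prl : {linear iota_mod -> M} := fst.
Let prr : {linear iota_mod -> R^o} := snd.

(* the matrix (tau_M, m 1 ; 0, 1), with columns M and R *)
Definition iota_tau (x : germ J (twist iota_mod)) : germ J iota_mod :=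
  let x1 := germ_map J (bc_map tau prl) x in
  let x2 := unit_tau (germ_map J (bc_map tau prr) x) in
  germ_map J inlM (mtau M x1 + gmul x2 m) + germ_map J inrM x2.

Lemma iota_tau_linear : linear iota_tau.
Proof.
move=> a x y; rewrite /iota_tau; cbv zeta; rewrite !linearP gmul_linear.
rewrite (addrACA (a *: _)) -scalerDr !linearP scalerDr.
by rewrite addrACA.
Qed.
HB.instance Definition _ := GRing.isLinear.Build R
  (germ J (twist iota_mod)) (germ J iota_mod) *:%R iota_tau iota_tau_linear.


Section SumMaps.
Variable T : lmodType R -> lmodType R.
Variable Tm : forall M N : lmodType R, {linear M -> N} -> {linear T M -> T N}.
Hypothesis Tcomp : forall (A B C : lmodType R) (g : {linear B -> C})
  (h : {linear A -> B}) (k : {linear A -> C}),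
  (forall a, k a = g (h a)) -> forall x, Tm k x = Tm g (Tm h x).
Hypothesis Tid : forall (A : lmodType R) (k : {linear A -> A}),
  (forall a, k a = a) -> forall x, Tm k x = x.
Hypothesis Tadd : forall (A B : lmodType R) (h k l : {linear A -> B}),
  (forall a, l a = h a + k a) -> forall x, Tm l x = Tm h x + Tm k x.
Hypothesis Tzero : forall (A B : lmodType R) (k : {linear A -> B}),
  (forall a, k a = 0) -> forall x, Tm k x = 0.

Lemma sum_mapsP :
  [/\ forall x, Tm prl (Tm inlM x) = x, forall x, Tm prr (Tm inlM x) = 0,
      forall x, Tm prl (Tm inrM x) = 0, forall x, Tm prr (Tm inrM x) = x &
      forall x, Tm inlM (Tm prl x) + Tm inrM (Tm prr x) = x].
Proof.
split=> x.
- by rewrite -(Tcomp (k := idfun)) // Tid.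
- by rewrite -(Tcomp (k := \0)) // Tzero.
- by rewrite -(Tcomp (k := \0)) // Tzero.
- by rewrite -(Tcomp (k := idfun)) // Tid.
rewrite -(Tcomp (k := inlM \o prl)) // -(Tcomp (k := inrM \o prr)) //.
rewrite -(Tadd (l := idfun)) ?Tid // => -[a b].
by apply: (congr2 pair) => /=; rewrite ?addr0 ?add0r.
Qed.

End SumMaps.

Lemma bc_map_comp (A B C : lmodType R) (g : {linear B -> C})
  (h : {linear A -> B}) (k : {linear A -> C}) :
  (forall a, k a = g (h a)) -> forall x, bc_map tau k x = bc_map tau g (bc_map tau h x).
Proof.
move=> e; apply: bc_eq_hom => [|u v|a s]; [exact: linearD|by rewrite !linearD|].
by rewrite !bc_mapE e.
Qed.

Lemma bc_map_id (A : lmodType R) (k : {linear A -> A}) :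
  (forall a, k a = a) -> forall x, bc_map tau k x = x.
Proof.
by move=> e; apply: bc_eq_hom => [|//|a s]; [exact: linearD|rewrite bc_mapE e].
Qed.

Lemma bc_map_add (A B : lmodType R) (h k l : {linear A -> B}) :
  (forall a, l a = h a + k a) ->
  forall x, bc_map tau l x = bc_map tau h x + bc_map tau k x.
Proof.
move=> e; apply: bc_eq_hom => [|u v|a s]; [exact: linearD| |].
  by rewrite !linearD addrACA.
by rewrite !bc_mapE e bcDl.
Qed.

Lemma bc_map_zero (A B : lmodType R) (k : {linear A -> B}) :
  (forall a, k a = 0) -> forall x, bc_map tau k x = 0.
Proof.
move=> e; apply: bc_eq_hom => [|u v|a s]; [exact: linearD|by rewrite addr0|].
by rewrite bc_mapE e -(scale0r (0 : B)) bc_bal rmorph0 mul0r -(mul0r (1 : R)) -bcZ scale0r.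
Qed.

Lemma germ_sum :
  [/\ forall x, germ_map J prl (germ_map J inlM x) = x,
      forall x, germ_map J prr (germ_map J inlM x) = 0,
      forall x, germ_map J prl (germ_map J inrM x) = 0,
      forall x, germ_map J prr (germ_map J inrM x) = x &
      forall x, germ_map J inlM (germ_map J prl x)
                + germ_map J inrM (germ_map J prr x) = x].
Proof.
apply: (@sum_mapsP (fun A => germ J A) (fun A B h => germ_map J h)) => *.
- exact: germ_map_comp.
- exact: germ_map_id.
- exact: germ_map_add.
- exact: germ_map_zero.
Qed.

Local Notation gt h := (germ_map J (bc_map tau h)).

Lemma germ_twist_sum :
  [/\ forall x, gt prl (gt inlM x) = x, forall x, gt prr (gt inlM x) = 0,
      forall x, gt prl (gt inrM x) = 0, forall x, gt prr (gt inrM x) = x &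
      forall x, gt inlM (gt prl x) + gt inrM (gt prr x) = x].
Proof.
apply: (@sum_mapsP (fun A => germ J (twist A)) (fun A B h => gt h)) => *.
- by apply: germ_map_comp => ?; exact: bc_map_comp.
- by apply: germ_map_id => ?; exact: bc_map_id.
- by apply: germ_map_add => ?; exact: bc_map_add.
- by apply: germ_map_zero => ?; exact: bc_map_zero.
Qed.

Lemma iota_tau_bij : bijective iota_tau.
Proof.
have [ti tiK tKi] := motive_iso M; have [ui uiK uKi] := unit_tau_bij.
have [g1 g2 g3 g4 g5] := germ_sum; have [h1 h2 h3 h4 h5] := germ_twist_sum.
exists (fun y => gt inlM (ti (germ_map J prl y - gmul (germ_map J prr y) m))
                 + gt inrM (ui (germ_map J prr y))) => y.
  rewrite /iota_tau; cbv zeta.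
  have El u v : germ_map J prl (germ_map J inlM u + germ_map J inrM v) = u.
    by rewrite linearD [X in X + _]g1 [X in _ + X]g3 addr0.
  have Er u v : germ_map J prr (germ_map J inlM u + germ_map J inrM v) = v.
    by rewrite linearD [X in X + _]g2 [X in _ + X]g4 add0r.
  by rewrite El Er addrK tiK uiK h5.
rewrite /iota_tau; cbv zeta.
have El u v : gt prl (gt inlM u + gt inrM v) = u.
  by rewrite linearD [X in X + _]h1 [X in _ + X]h3 addr0.
have Er u v : gt prr (gt inlM u + gt inrM v) = v.
  by rewrite linearD [X in X + _]h2 [X in _ + X]h4 add0r.
by rewrite El Er uKi tKi subrK g5.
Qed.

Lemma iota_lf : exists r, locally_free iota_mod r.
Proof.
have [r [s [hs hb]]] := motive_lf M.
exists (r + 1)%N, s; split=> // f /hb[e [e1 e2]].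
exists (fun i => match split i with inl j => (e j, 0) | inr _ => (0, 1) end : iota_mod).
have E (c : 'I_(r + 1) -> R) :
    \sum_i c i *: (match split i with inl j => (e j, 0) | inr _ => (0, 1) end : iota_mod)
    = (\sum_i c (lshift 1 i) *: e i, c (rshift r ord0)).
  rewrite big_split_ord big_ord1 (unsplitK (inr ord0)).
  under eq_bigr => i _ do rewrite (unsplitK (inl i)).
  rewrite [LHS]surjective_pairing; apply: (congr2 pair) => /=.
    rewrite (raddf_sum (@fst M R^o)) scaler0 addr0; exact: eq_bigr.
  rewrite (raddf_sum (@snd M R^o)) big1 => [|i _ /=]; last by rewrite scaler0.
  by rewrite add0r; exact: mulr1.
split=> [[x y]|c].
  have [k [c ec]] := e1 x.
  exists k, (fun i => match split i with inl j => c j | inr _ => f ^+ k * y end).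
  rewrite E (unsplitK (inr ord0)); under eq_bigr => i _ do rewrite (unsplitK (inl i)).
  by rewrite -ec.
rewrite E => -[/e2[k hk] c0]; exists k => i.
case: (split_ordP i) => j ->; first exact: hk.
by rewrite [j]ord1 c0 mulr0.
Qed.

Definition iota_motive : motive := Motive iota_lf iota_tau_bij.

Lemma iota_inc_map : @is_motive_map M iota_motive inlM.
Proof.
have [h1 h2 h3 h4 h5] := germ_twist_sum.
move=> x; rewrite /= /iota_tau; cbv zeta.
rewrite h1 h2 !linear0 addr0.
have -> : gmul 0 m = 0.
  by apply: (addrI (gmul 0 m)); rewrite -{1}[gmul 0 m]scale1r -gmul_linear scaler0 !addr0.
by rewrite addr0.
Qed.

Lemma iota_proj_map : @is_motive_map iota_motive unit_motive prr.
Proof.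
have [g1 g2 g3 g4 g5] := germ_sum.
move=> x; rewrite /= /iota_tau; cbv zeta.
by rewrite linearD [X in X + _]g2 [X in _ + X]g4 add0r.
Qed.

Lemma iota_inj : injective inlM.
Proof. by move=> x y []. Qed.

Lemma iota_surj (r : R^o) : exists x : iota_mod, prr x = r.
Proof. by exists (0, r). Qed.

Lemma iota_exact (x : iota_mod) : prr x = 0 <-> exists a, x = inlM a.
Proof.
case: x => a b; split=> [/= ->|[c [_ ->]] //]; by exists a.
Qed.

Definition iota_ext : extension := @Extension iota_motive inlM prr
  iota_inc_map iota_proj_map iota_inj iota_surj iota_exact.

Definition iota : Ext1 := cls_ext iota_ext.

End Iota.
End Extension.
End Motive.

Section Completion.
Variables (R : comPzRingType) (L : set R).
Local Notation pow := (ideal_pow setT L).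

Record cohseq := CohSeq {
  cseq :> nat -> R;
  cseqP : forall n, pow n (cseq n.+1 - cseq n) }.

HB.instance Definition _ := gen_eqMixin cohseq.
HB.instance Definition _ := gen_choiceMixin cohseq.

Definition coh_eq (x y : cohseq) : bool := `[< forall n, pow n (x n - y n) >].

Lemma coh_eq_refl : reflexive coh_eq.
Proof. by move=> x; apply/asboolP => n; rewrite subrr; exact: pow0. Qed.
Lemma coh_eq_sym : symmetric coh_eq.
Proof.
by move=> x y; apply/asboolP/asboolP => h n; rewrite -opprB; apply: powN.
Qed.
Lemma coh_eq_trans : transitive coh_eq.
Proof.
move=> y x z /asboolP h1 /asboolP h2; apply/asboolP => n.
by rewrite -(subrKA (y n)); apply: powD.
Qed.

Canonical coh_eq_equiv := EquivRel coh_eq coh_eq_refl coh_eq_sym coh_eq_trans.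

(* lim_n R / L ^ n: sequences of representatives x n of compatible classes mod
   L ^ n, modulo x ~ y iff x n = y n mod L ^ n for all n. *)
Definition completion : Type := {eq_quot coh_eq}.
HB.instance Definition _ := Choice.on completion.

Definition ccls (x : cohseq) : completion := \pi_{eq_quot coh_eq} x.
Definition crep (x : completion) : cohseq := repr (x : {eq_quot coh_eq}).

Lemma crepK x : ccls (crep x) = x. Proof. exact: reprK. Qed.
Lemma ccls_eq (x y : cohseq) : (forall n, pow n (x n - y n)) -> ccls x = ccls y.
Proof. by move=> h; apply/eqmodP/asboolP. Qed.
Lemma crep_cls x n : pow n (crep (ccls x) n - x n).
Proof.
by have /eqmodP /asboolP : ccls (crep (ccls x)) = ccls x by rewrite crepK.
Qed.

Lemma cconstP (a : R) n : pow n (a - a).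
Proof. by rewrite subrr; exact: pow0. Qed.
Definition cconst a := CohSeq (cconstP a).

Lemma csaddP (x y : cohseq) n : pow n ((x n.+1 + y n.+1) - (x n + y n)).
Proof. by rewrite opprD addrACA; apply: powD; exact: cseqP. Qed.
Definition csadd x y := CohSeq (csaddP x y).

Lemma csoppP (x : cohseq) n : pow n (- x n.+1 - - x n).
Proof. by rewrite -opprD; apply: powN; exact: cseqP. Qed.
Definition csopp x := CohSeq (csoppP x).

Lemma pow_subM n (a b a' b' : R) :
  pow n (a - a') -> pow n (b - b') -> pow n (a * b - a' * b').
Proof.
move=> ha hb; rewrite -(subrKA (a' * b)) -mulrBl -mulrBr.
by apply: powD; [rewrite mulrC|]; apply: powM.
Qed.

Lemma csmulP (x y : cohseq) n : pow n ((x n.+1 * y n.+1) - (x n * y n)).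
Proof. by apply: pow_subM; exact: cseqP. Qed.
Definition csmul x y := CohSeq (csmulP x y).

Definition cadd x y := ccls (csadd (crep x) (crep y)).
Definition copp x := ccls (csopp (crep x)).
Definition cmul x y := ccls (csmul (crep x) (crep y)).
Definition cemb (a : R) : completion := ccls (cconst a).

Lemma caddE x y : cadd (ccls x) (ccls y) = ccls (csadd x y).
Proof.
apply: ccls_eq => n /=; rewrite opprD addrACA.
by apply: powD; exact: crep_cls.
Qed.
Lemma coppE x : copp (ccls x) = ccls (csopp x).
Proof.
by apply: ccls_eq => n /=; rewrite -opprD; apply: powN; exact: crep_cls.
Qed.
Lemma cmulE x y : cmul (ccls x) (ccls y) = ccls (csmul x y).
Proof. by apply: ccls_eq => n /=; apply: pow_subM; exact: crep_cls. Qed.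

Lemma ccls_ext (x y : cohseq) : x =1 y -> ccls x = ccls y.
Proof. by move=> e; apply: ccls_eq => n; rewrite e subrr; exact: pow0. Qed.

Lemma caddA : associative cadd.
Proof.
move=> x y z; rewrite -(crepK x) -(crepK y) -(crepK z) !caddE.
by apply: ccls_ext => n /=; rewrite addrA.
Qed.
Lemma caddC : commutative cadd.
Proof.
move=> x y; rewrite -(crepK x) -(crepK y) !caddE.
by apply: ccls_ext => n /=; rewrite addrC.
Qed.
Lemma cadd0 : left_id (cemb 0) cadd.
Proof.
move=> x; rewrite -(crepK x) caddE.
by apply: ccls_ext => n /=; rewrite add0r.
Qed.
Lemma caddN : left_inverse (cemb 0) copp cadd.
Proof.
move=> x; rewrite -(crepK x) coppE caddE.
by apply: ccls_ext => n /=; rewrite addNr.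
Qed.
HB.instance Definition _ := GRing.isZmodule.Build completion caddA caddC cadd0 caddN.

Lemma cmulA : associative cmul.
Proof.
move=> x y z; rewrite -(crepK x) -(crepK y) -(crepK z) !cmulE.
by apply: ccls_ext => n /=; rewrite mulrA.
Qed.
Lemma cmulC : commutative cmul.
Proof.
move=> x y; rewrite -(crepK x) -(crepK y) !cmulE.
by apply: ccls_ext => n /=; rewrite mulrC.
Qed.
Lemma cmul1 : left_id (cemb 1) cmul.
Proof.
move=> x; rewrite -(crepK x) cmulE.
by apply: ccls_ext => n /=; rewrite mul1r.
Qed.
Lemma cmulDl : left_distributive cmul +%R.
Proof.
have E x y : ccls x + ccls y = ccls (csadd x y) := caddE x y.
move=> x y z; rewrite -(crepK x) -(crepK y) -(crepK z) E !cmulE E.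
by apply: ccls_ext => n /=; rewrite mulrDl.
Qed.
HB.instance Definition _ :=
  GRing.Zmodule_isComPzRing.Build completion cmulA cmulC cmul1 cmulDl.

Lemma cemb_nmod : nmod_morphism cemb.
Proof. by split=> // x y; rewrite [RHS]caddE; exact: ccls_ext. Qed.
Lemma cemb_monoid : monoid_morphism cemb.
Proof. by split=> // x y; rewrite [RHS]cmulE; exact: ccls_ext. Qed.
HB.instance Definition _ := GRing.isNmodMorphism.Build R completion cemb cemb_nmod.
HB.instance Definition _ := GRing.isMonoidMorphism.Build R completion cemb cemb_monoid.

Section Map.
Variables (f : {rmorphism R -> R}).

Lemma pow_map (fL : forall x, L x -> L (f x)) n x : pow n x -> pow n (f x).
Proof.
move: x; apply: (@span_min R R^o) => [|x y hx hy|a x hx|x [a ha ->]].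
- by rewrite rmorph0; exact: pow0.
- by rewrite rmorphD; exact: powD.
- by rewrite rmorphM; exact: powM.
rewrite rmorph_prod; apply: (@span_gen R R^o).
by exists (fun i => f (a i)) => // i; apply: fL.
Qed.

Variable fL : forall x, L x -> L (f x).

Lemma csmapP (x : cohseq) n : pow n (f (x n.+1) - f (x n)).
Proof. by rewrite -rmorphB; apply: (pow_map fL); exact: cseqP. Qed.
Definition csmap x := CohSeq (csmapP x).

Definition cmap (x : completion) : completion := ccls (csmap (crep x)).

Lemma cmapE x : cmap (ccls x) = ccls (csmap x).
Proof.
by apply: ccls_eq => n /=; rewrite -rmorphB; apply: (pow_map fL); exact: crep_cls.
Qed.

Lemma cmap_nmod : nmod_morphism cmap.
Proof.
have E x y : ccls x + ccls y = ccls (csadd x y) := caddE x y.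
split; first by rewrite cmapE; apply: ccls_ext => n /=; rewrite rmorph0.
move=> x y; rewrite -(crepK x) -(crepK y) E !cmapE E.
by apply: ccls_ext => n /=; rewrite rmorphD.
Qed.
Lemma cmap_monoid : monoid_morphism cmap.
Proof.
have E x y : ccls x * ccls y = ccls (csmul x y) := cmulE x y.
split; first by rewrite cmapE; apply: ccls_ext => n /=; rewrite rmorph1.
move=> x y; rewrite -(crepK x) -(crepK y) E !cmapE E.
by apply: ccls_ext => n /=; rewrite rmorphM.
Qed.
HB.instance Definition _ := GRing.isNmodMorphism.Build _ _ cmap cmap_nmod.
HB.instance Definition _ := GRing.isMonoidMorphism.Build _ _ cmap cmap_monoid.

Lemma cmap_emb a : cmap (cemb a) = cemb (f a).
Proof. by rewrite cmapE; exact: ccls_ext. Qed.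

End Map.
End Completion.

(* A normalized discrete valuation; the value v 0 is irrelevant. *)
Definition discrete_valuation (K : fieldType) (v : K -> int) : Prop :=
  [/\ exists2 x, x != 0 & v x = 1,
      forall x y, x != 0 -> y != 0 -> v (x * y) = v x + v y &
      forall x y, x != 0 -> y != 0 -> x + y != 0 ->
        Num.min (v x) (v y) <= v (x + y)].

Definition valuation_ring (K : fieldType) (v : K -> int) : set K :=
  [set x | x = 0 \/ 0 <= v x].

Definition function_field (F K : fieldType) (iK : {rmorphism F -> K}) : Prop :=
  exists t : K,
    (forall p : {poly F}, p != 0 -> (map_poly iK p).[t] != 0) /\
    exists n (b : 'I_n -> K), forall x, exists p q : 'I_n -> {poly F},
      (forall i, q i != 0) /\
      x = \sum_i (map_poly iK (p i)).[t] / (map_poly iK (q i)).[t] * b i.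

(* Spec (K (x)_F L) is irreducible, i.e. its nilradical is prime, for all L. *)
Definition geometrically_irreducible (F K : fieldType) (iK : {rmorphism F -> K}) : Prop :=
  forall (L : fieldType) (iL : {rmorphism F -> L}) (x y : tring iK iL),
    (exists n, (x * y) ^+ n = 0) ->
    (exists n, x ^+ n = 0) \/ (exists n, y ^+ n = 0).

(* A smooth (= regular, F being perfect) projective curve over a finite field is
   determined by its function field K: its closed points are the discrete
   valuation rings of K, which serve as local rings (valuations are trivial on
   the finite field F). *)
Definition closed_point (K : fieldType) (P : set K) : Prop :=
  exists v, discrete_valuation v /\ P = valuation_ring v.

(* jA identifies A with the ring of functions regular away from Pinf. *)
Definition regular_functions (F K : fieldType) (iK : {rmorphism F -> K})
    (Pinf : set K) (A : comNzRingType) (iA : {rmorphism F -> A})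
    (jA : {rmorphism A -> K}) : Prop :=
  [/\ injective jA, forall c, jA (iA c) = iK c &
      range jA = [set x | forall P, closed_point P -> P <> Pinf -> P x]].

(* Local fields: complete for a discrete valuation with finite residue field. *)
Definition local_field (K : fieldType) (v : K -> int) : Prop :=
  [/\ discrete_valuation v,
      forall u : nat -> K,
        (forall N : int, exists n0, forall m n, (n0 <= m)%N -> (n0 <= n)%N ->
           u m = u n \/ N <= v (u m - u n)) ->
        exists l, forall N : int, exists n0, forall n, (n0 <= n)%N ->
           u n = l \/ N <= v (u n - l) &
      exists s : seq K, forall x, valuation_ring v x ->
        exists2 y, y \in s & x = y \/ 0 < v (x - y)].

Definition separable_closure (K Ks : fieldType) (js : {rmorphism K -> Ks}) : Prop :=
  (forall x, exists2 p : {poly K}, separable_poly p & root (map_poly js p) x) /\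
  (forall p : {poly Ks}, separable_poly p -> size p != 1%N -> exists x, root p x).

Record galois_elt (K Ks : fieldType) (js : {rmorphism K -> Ks}) := GaloisElt {
  gal_fun :> {rmorphism Ks -> Ks};
  gal_bij : bijective gal_fun;
  gal_fix : forall x, gal_fun (js x) = js x }.

Section GaloisMul.
Variables (K Ks : fieldType) (js : {rmorphism K -> Ks}) (s t : galois_elt js).

Lemma gal_mul_fix x : (s \o t) (js x) = js x.
Proof. by rewrite /= !gal_fix. Qed.

Definition gal_mul : galois_elt js :=
  GaloisElt (bij_comp (gal_bij s) (gal_bij t) : bijective (s \o t : {rmorphism Ks -> Ks}))
    gal_mul_fix.

End GaloisMul.

Section Inertia.
Variables (K Ks : fieldType) (js : {rmorphism K -> Ks}) (v : K -> int).

(* the integral closure of the valuation ring in Ks, and its maximal ideal *)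
Definition integral_closure : set Ks :=
  [set x | exists2 p : {poly K}, p \is monic /\ (forall i, valuation_ring v p`_i)
         & root (map_poly js p) x].

Definition integral_closure_max : set Ks :=
  [set x | integral_closure x /\ (x = 0 \/ ~ integral_closure x^-1)].

Definition inertia : set (galois_elt js) :=
  [set s | forall x, integral_closure x -> integral_closure_max (s x - x)].

End Inertia.

Definition is_ideal (A : pzRingType) (I : set A) : Prop :=
  [/\ I 0, forall x y, I x -> I y -> I (x + y) & forall a x, I x -> I (a * x)].

Definition maximal_ideal (A : comPzRingType) (l : set A) : Prop :=
  [/\ is_ideal l, ~ l 1 & forall I, is_ideal I -> ~ I 1 -> l `<=` I -> I = l].

Section Frobenius.
Variables (F : finFieldType) (C : fieldType) (iC : {rmorphism F -> C}).

Definition qfrob of {rmorphism F -> C} := fun x : C => x ^+ #|F|.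

Lemma qfrob_zmod : zmod_morphism (qfrob iC).
Proof.
have [p _ chF] := finPcharP F.
have chC : p \in [pchar C] by rewrite -(fmorph_pchar iC) in chF *.
rewrite /qfrob (card_pprimeChar chF); elim: (logn _ _) => [|n IHn] x y //.
by rewrite expnSr !exprM IHn -!(pFrobenius_autE chC) rmorphB.
Qed.

Lemma qfrob_monoid : monoid_morphism (qfrob iC).
Proof. by split=> [|x y]; rewrite /qfrob ?expr1n ?exprMn. Qed.

HB.instance Definition _ := GRing.isZmodMorphism.Build C C (qfrob iC) qfrob_zmod.
HB.instance Definition _ := GRing.isMonoidMorphism.Build C C (qfrob iC) qfrob_monoid.

Lemma qfrob_fix r : qfrob iC (iC r) = iC r.
Proof. by rewrite /qfrob -rmorphXn expf_card. Qed.

End Frobenius.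

Section Local.
Variables (F : finFieldType) (A : comNzRingType) (iA : {rmorphism F -> A}).
Variables (Fp : fieldType) (iF : {rmorphism F -> Fp}) (v : Fp -> int).
Variable kappa : {rmorphism A -> Fp}.

(* A (x) Fp, with tau (a (x) x) = a (x) x ^ q *)
Definition AF : comPzRingType := tring iA iF.
Definition tauF : {rmorphism AF -> AF} := tring_map (g := qfrob iF) (qfrob_fix iF).

(* A (x) Op, as a subring of A (x) Fp (A is flat over F) *)
Definition AO : set AF :=
  [set x | exists s : seq (A * Fp), (forall z, z \in s -> valuation_ring v z.2) /\
     x = \sum_(z <- s) tr iA iF z.1 z.2].

Definition j_gen : set AF := [set x | exists a, x = tr iA iF a 1 - tr iA iF 1 (kappa a)].
Definition jF : set AF := ideal_gen setT j_gen.
Definition jO : set AF := ideal_gen AO j_gen.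

Definition Amotive : Type := motive tauF jF.

Section Models.
Variable M : Amotive.

(* L[jO^-1] inside M[jF^-1], for an (A (x) Op)-submodule L of M *)
Definition model_inv (L : set M) : set (germ jF M) :=
  [set x | exists n, forall y, ideal_pow AO jO n y ->
     exists2 l, L l & y *: x = loc jF l].

Definition is_model (L : set M) : Prop :=
  [/\ exists s : seq M, L = span AO [set x | x \in s],
      span setT L = setT &
      forall l c, L l -> AO c -> model_inv L (mtau M (loc jF (bc tauF l c)))].

Definition is_maximal_model (L : set M) : Prop :=
  is_model L /\ forall L', is_model L' -> L' `<=` L.

(* Ext^1_Op(1, M) = iota (M_Op[j^-1]) *)
Definition Ext1_O (x : Ext1 M) : Prop :=
  exists L, is_maximal_model L /\ exists2 m, model_inv L m & x = iota m.

End Models.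

Variables (Fs : fieldType) (js : {rmorphism Fp -> Fs}) (l : set A).

Let iS : {rmorphism F -> Fs} := js \o iF.

Definition AS : comPzRingType := tring iA iS.
Definition tauS : {rmorphism AS -> AS} := tring_map (g := qfrob iS) (qfrob_fix iS).
Definition galS_fix (s : galois_elt js) r : s (iS r) = iS r := gal_fix s (iF r).
Definition galS (s : galois_elt js) : {rmorphism AS -> AS} :=
  tring_map (g := s) (galS_fix s).
Definition AFS : {rmorphism AF -> AS} :=
  tring_map (g := js) (fun r => erefl (iS r)).

Definition lS : set AS := ideal_gen setT [set x | exists2 a, l a & x = tr iA iS a 1].

Lemma lS_stable (f : {rmorphism AS -> AS}) :
  (forall a, f (tr iA iS a 1) = tr iA iS a 1) -> forall x, lS x -> lS (f x).
Proof.
move=> e; apply: (@span_min AS AS^o) => [|x y hx hy|a x hx|x [a la ->]].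
- by rewrite rmorph0; exact: span0.
- by rewrite rmorphD; exact: spanD.
- by rewrite rmorphM; exact: (@spanZ AS AS^o).
by rewrite e; apply: (@span_gen AS AS^o); exists a.
Qed.

Lemma tauS_l x : lS x -> lS (tauS x).
Proof.
by move: x; apply: lS_stable => a; rewrite /tauS /= tring_mapE rmorph1.
Qed.

Lemma galS_l (s : galois_elt js) x : lS x -> lS (galS s x).
Proof.
by move: x; apply: lS_stable => a; rewrite /galS /= tring_mapE rmorph1.
Qed.

Definition Al : comPzRingType := completion lS.
Definition tauAl : {rmorphism Al -> Al} := cmap tauS_l.
Definition galAl (s : galois_elt js) : {rmorphism Al -> Al} := cmap (galS_l s).
Definition AFl : {rmorphism AF -> Al} := cemb lS \o AFS.

Lemma tauAl_AFl x : tauAl (AFl x) = AFl (tauF x).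
Proof.
rewrite /tauAl /= cmap_emb; congr cemb; move: x; apply: tring_eq_hom.
- by move=> x y; rewrite !rmorphD.
- by move=> x y; rewrite !rmorphD.
by move=> b c; rewrite /= !tring_mapE; congr tr; exact/esym/rmorphXn.
Qed.

Lemma galAl_AFl s x : galAl s (AFl x) = AFl x.
Proof.
rewrite /galAl /= cmap_emb; congr cemb; move: x; apply: tring_eq_hom.
- by move=> x y; rewrite !rmorphD.
- by move=> x y; rewrite !rmorphD.
by move=> b c; rewrite /= !tring_mapE gal_fix.
Qed.

Section Tate.
Variable M : Amotive.

Definition Ml : lmodType Al := base_change AFl M.
Definition Mjl : lmodType Al := base_change AFl (germ jF M).

(* m |-> tau_M (tau^* m), from M (x) Al to M[j^-1] (x) Al. When kappa(l) generates
   the unit ideal, j is invertible in Al and M (x) Al = M[j^-1] (x) Al. *)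
Definition tate_tau (z : Ml) : Mjl :=
  tlift (fun m a => bc AFl (mtau M (loc jF (bc tauF m 1))) (tauAl a)) z.

Definition tate : set Ml := [set z | tate_tau z = bc_map AFl (loc jF) z].

Definition gal_act (s : galois_elt js) (z : Ml) : Ml :=
  tlift (fun m a => bc AFl m (galAl s a)) z.

Lemma tate_tau_bal :
  balanced (fun r (m : M) => r *: m) (fun r (a : Al) => AFl r * a)
    (fun m a => bc AFl (mtau M (loc jF (bc tauF m 1))) (tauAl a)).
Proof.
split=> [n x y|m x y|r m n]; first by rewrite bcDl !linearD bcDl.
- by rewrite rmorphD bcDr.
- by rewrite rmorphM tauAl_AFl bc_bal -bcZ !linearZ bc_bal.
Qed.

Lemma gal_act_bal s :
  balanced (fun r (m : M) => r *: m) (fun r (a : Al) => AFl r * a)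
    (fun m a => bc AFl m (galAl s a)).
Proof.
split=> [n x y|m x y|r m n]; first by rewrite bcDl.
- by rewrite rmorphD bcDr.
- by rewrite rmorphM galAl_AFl bc_bal.
Qed.

(* l ^ n T_l M *)
Definition tate_pow (n : nat) : set Ml :=
  span [set AFl (tr iA iF a 1) | a in ideal_pow setT l n] tate.

(* continuous 1-cocycles and 1-coboundaries of the inertia group in T_l M; the
   values of c off the inertia group are irrelevant *)
Definition inertia_cocycle (c : galois_elt js -> Ml) : Prop :=
  [/\ forall s, inertia v s -> tate (c s),
      forall s t, inertia v s -> inertia v t ->
        c (gal_mul s t) = c s + gal_act s (c t) &
      forall n, exists X : seq Fs, forall s t, inertia v s -> inertia v t ->
        (forall x, x \in X -> s x = t x) -> tate_pow n (c s - c t)].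

Definition inertia_coboundary (c : galois_elt js -> Ml) : Prop :=
  exists2 t, tate t & forall s, inertia v s -> c s = gal_act s t - t.

End Tate.

Section Good.
Variable M : Amotive.

(* c represents the class of 0 -> T_l M -> T_l E -> T_l 1 = O_l -> 0 in
   H^1(I, T_l M): c s = s e - e for a lift e in T_l E of 1 in O_l. *)
Definition connecting_cocycle (E : extension M) (c : galois_elt js -> Ml M) : Prop :=
  inertia_cocycle c /\
  exists e : Ml E, [/\ tate e,
    bc_map AFl (eproj E) e = bc AFl (1 : AF^o) 1 &
    forall s, inertia v s -> bc_map AFl (einc E) (c s) = gal_act s e - e].

(* kernel of Ext^1(1, M) -> H^1(I, T_l M) *)
Definition Ext1_good (x : Ext1 M) : Prop :=
  exists E, ext_class x E /\
  exists2 c, connecting_cocycle E c & inertia_coboundary c.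

End Good.
End Local.
Arguments Ext1_O {F A iA Fp iF} v {kappa M} x.
Arguments Ext1_good {F A iA Fp iF} v {kappa Fs} js l {M} x.

(* Main.v *)
(* An extension class iota(m) with m in L[j^-1], for a model L with generators e_i, has trivial
   image in H^1(I, T_l M) as soon as the lift (z, 1) of 1 to T_l E can be chosen invariant
   under inertia; here z in M (x) A_l(F^s) has to satisfy z - tau_M(tau^* z) = m. Since l
   generates the unit ideal of O_p, some w = 1 mod l lies in j; multiplying by a power y of w
   clears the denominators and turns the equation into a system y a = B tau(a) + c with
   coefficients in A (x) O_p for the coordinates a of z. It is solved modulo l^n successively:
   as A / l is algebraic over the finite field F, each step is a system x = B x^(q) + d over
   O_p, which has a solution in the valuation ring of the maximal unramified extension, on
   which inertia acts trivially. *)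

Require Import Defs.
From mathcomp Require Import all_boot all_order all_algebra separable finfield ring.
From mathcomp Require Import boolp classical_sets.

Set Implicit Arguments.
Unset Strict Implicit.
Unset Printing Implicit Defensive.

Import Order.TTheory GRing.Theory Num.Theory.

Local Open Scope classical_set_scope.
Local Open Scope ring_scope.

(** * Residue rings of A are algebraic over F *)

(** The equation to solve is x - Phi x = d with Phi x = B x^(q). The generators of a model need not
    be a basis, so B is just some integral matrix and Lang's theorem for invertible matrices does
    not apply; what helps is that the linear part of x - Phi x is the identity. The separable
    closure comes without a valuation or completeness, so limits are not taken there: vectors and
    series stay over [Fp], where Phi contracts positive valuations, and only scalars fixed by a
    power of Frobenius are taken from [Fs]. New scalars of this kind come from one Artin-Schreier
    equation. On the side of A, no basis of l^n / l^(n+1) is set up: for every x two powers of x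
    agree modulo l, and this suffices to build finite families stable under multiplication. The
    factor y is harmless, being 1 modulo l: it acts as 1 in each correction step and becomes
    invertible in [Al]. *)

Lemma finType_pigeonhole (T : finType) (f : nat -> T) :
  exists i j, (i < j)%N /\ f i = f j.
Proof.
have : ~~ injectiveb (fun i : 'I_#|T|.+1 => f i).
  apply/negP => /injectiveP /leq_card; by rewrite card_ord ltnn.
case/injectivePn => i [j ij e].
case: (ltngtP i j) => [lt|lt|/val_inj /eqP]; last by rewrite (negPf ij).
  by exists i, j.
by exists j, i.
Qed.

Section FunctionField.
Variables (F : finFieldType) (K : fieldType) (iK : {rmorphism F -> K}).
Variables (t : K) (n : nat) (b : 'I_n -> K).

Let ev (p : {poly F}) : K := (map_poly iK p).[t].

Let evM p q : ev (p * q) = ev p * ev q.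
Proof. by rewrite /ev rmorphM hornerM. Qed.

Let ev_prod (I : finType) (P : pred I) (p : I -> {poly F}) :
  ev (\prod_(i | P i) p i) = \prod_(i | P i) ev (p i).
Proof. by rewrite /ev rmorph_prod horner_prod. Qed.

Let ev_sum (I : finType) (p : I -> {poly F}) :
  ev (\sum_i p i) = \sum_i ev (p i).
Proof. by rewrite /ev rmorph_sum horner_sum. Qed.

(** For fixed [d] these elements are the image of an F-space of dimension [n * d]; the counting
    argument needs only how [d] grows under products. *)
Let bounded (d : nat) (y : K) : Prop :=
  exists p : 'I_n -> {poly F},
    (forall k, (size (p k) <= d)%N) /\ y = \sum_k ev (p k) * b k.

Let bounded_sum d (I : finType) (y : I -> K) :
  (forall i, bounded d (y i)) -> bounded d (\sum_i y i).
Proof.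
move=> /choice[p hp]; exists (fun k => \sum_i p i k); split=> [k|].
  apply: leq_trans (size_sum _ _ _) _.
  by apply/bigmax_leqP => i _; case: (hp i).
under [RHS]eq_bigr => k _ do rewrite ev_sum mulr_suml.
rewrite exchange_big /=; apply: eq_bigr => i _.
by case: (hp i).
Qed.

Let bounded_mul d e (r : {poly F}) y :
  (size r <= e)%N -> bounded d y -> bounded (d + e) (ev r * y).
Proof.
move=> hr [p [hp ->]]; exists (fun k => r * p k); split=> [k|].
  apply: leq_trans (size_polyMleq _ _) _; rewrite addnC.
  by apply: leq_trans (leq_pred _) _; exact: leq_add.
by rewrite mulr_sumr; apply: eq_bigr => k _; rewrite evM mulrA.
Qed.

Let bounded_le d e y : (d <= e)%N -> bounded d y -> bounded e y.
Proof.
move=> le [p [hp ->]]; exists p; split=> // k; exact: leq_trans (hp k) le.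
Qed.

Hypothesis transc : forall p : {poly F}, p != 0 -> ev p != 0.
Hypothesis gen : forall x, exists p q : 'I_n -> {poly F},
  (forall i, q i != 0) /\ x = \sum_i ev (p i) / ev (q i) * b i.

Let denominator x : exists2 D : {poly F}, D != 0 & exists d, bounded d (ev D * x).
Proof.
have [p [q [q0 ->]]] := gen x; exists (\prod_i q i).
  by apply/prodf_neq0 => i _.
pose P k := p k * \prod_(i | i != k) q i.
exists (\max_k size (P k)), P; split=> [k|]; first exact: leq_bigmax.
rewrite mulr_sumr; apply: eq_bigr => k _.
rewrite /P evM !ev_prod (bigD1 k) //= mulrA; congr (_ * _).
by rewrite mulrC mulrA divfK ?transc.
Qed.

Let common_denominator (I : finType) (x : I -> K) :
  exists2 D : {poly F}, D != 0 & exists2 d, (size D <= d)%N & forall i, bounded d (ev D * x i).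
Proof.
have /choice[D hD] : forall i, exists D : {poly F}, D != 0 /\ exists d, bounded d (ev D * x i).
  by move=> i; have [D D0 h] := denominator (x i); exists D.
have /choice[d hd] : forall i, exists d, bounded d (ev (D i) * x i).
  by move=> i; case: (hD i).
pose C i := \prod_(j | j != i) D j.
exists (\prod_i D i); first by apply/prodf_neq0 => i _; case: (hD i).
pose m := \max_i (d i + size (C i))%N.
exists (maxn (size (\prod_i D i)) m) => [|i]; first exact: leq_maxl.
rewrite (bigD1 i) //= [D i * _]mulrC evM -mulrA.
apply: bounded_le (bounded_mul (leqnn _) (hd i)).
by apply: leq_trans (leq_maxr _ _); exact: (leq_bigmax (F := fun i => d i + size (C i))%N).
Qed.

(* D^(2N) a^i x^j, for i, j < N, are N^2 elements of a space whose dimension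
   grows linearly with N. *)
Lemma algebraic_dependence (a x : K) :
  exists N (c : 'I_N -> 'I_N -> F), (exists i j, c i j != 0) /\
    \sum_i \sum_j iK (c i j) * (a ^+ i * x ^+ j) = 0.
Proof.
(* Clearing the denominators of 1 and of all products of [a] and [x] with the [b j] lets each
   multiplication by D a or D x cost the same [d]. *)
pose y (i : option ('I_n + 'I_n)) : K :=
  match i with None => 1 | Some (inl j) => a * b j | Some (inr j) => x * b j end.
have [D D0 [d hD hd]] := common_denominator y.
have step z (hz : forall j, bounded d (ev D * (z * b j))) e w :
    bounded e w -> bounded (d + e) (ev D * z * w).
  move=> [p [hp ->]]; rewrite mulr_sumr; apply: bounded_sum => k.
  by rewrite mulrCA -mulrA; apply: bounded_mul.
have pow z (hz : forall j, bounded d (ev D * (z * b j))) i e w :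
    bounded e w -> bounded (i * d + e) (ev D ^+ i * z ^+ i * w).
  move=> hw; elim: i => [|i IH]; first by rewrite !expr0 !mul1r.
  have -> : ev D ^+ i.+1 * z ^+ i.+1 * w = ev D * z * (ev D ^+ i * z ^+ i * w).
    by rewrite !exprS; ring.
  by rewrite mulSn -addnA; exact: step.
(* This makes N * N exceed n * (N * (2 * d)), the number of coefficients available. *)
pose N := (n * (2 * d)).+1.
have mono (i j : 'I_N) : bounded (N * (2 * d)) (ev D ^+ (2 * N) * (a ^+ i * x ^+ j)).
  have h1 : bounded d (ev D * 1) := hd None.
  have := pow _ (fun k => hd (Some (inl k))) i _ _
    (pow _ (fun k => hd (Some (inr k))) j _ _ h1).
  (* Padding by D^k gives all monomials the same factor D^(2N); the 1 counts the factor D of the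
     starting element D * 1. *)
  set k := (2 * N - (i + j + 1))%N.
  have le : (i + j + 1 + k = 2 * N)%N.
    apply: subnKC; rewrite addn1 mul2n -addnn -addnS; apply: leq_add; last exact: ltn_ord.
    exact: ltnW (ltn_ord i).
  have powD l e w : bounded e w -> bounded (l * d + e) (ev D ^+ l * w).
    move=> hw; elim: l => [|l IH]; first by rewrite mul1r.
    by rewrite exprS -mulrA mulSn -addnA addnC; exact: bounded_mul.
  move=> /(powD k); have -> : (k * d + (i * d + (j * d + d)) = N * (2 * d))%N.
    by rewrite [RHS]mulnCA mulnA -le !mulnDl mul1n addnC !addnA.
  congr bounded; rewrite -le !exprD expr1 mulr1.
  ring.
pose S := (N * (2 * d))%N.
have /choice[w hw] : forall ij : 'I_N * 'I_N, exists p : 'I_n -> {poly F},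
    (forall k, (size (p k) <= S)%N) /\
    ev D ^+ (2 * N) * (a ^+ ij.1 * x ^+ ij.2) = \sum_k ev (p k) * b k.
  by move=> [i j]; exact: mono.
pose W (c : {ffun 'I_N * 'I_N -> F}) : {ffun 'I_n * 'I_S -> F} :=
  [ffun kl : 'I_n * 'I_S => \sum_ij c ij * (w ij kl.1)`_(kl.2)].
have : ~~ injectiveb W.
  apply/negP => /injectiveP /leq_card.
  rewrite !card_ffun !card_prod !card_ord leq_exp2l; last exact: card_finNzRing_gt1.
  by rewrite /S mulnCA leq_mul2l /= ltnn.
case/injectivePn => c [c' cc' e].
exists N, (fun i j => c (i, j) - c' (i, j)); split.
  have /forallPn[[i j] hij] : ~~ [forall ij, c ij == c' ij].
    by apply: contra cc' => /forallP h; apply/eqP/ffunP => ij; exact/eqP.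
  by exists i, j; rewrite subr_eq0.
have zero k : \sum_ij (c ij - c' ij)%:P * w ij k = 0.
  apply/polyP => l; rewrite coef_sum coef0.
  case: (ltnP l S) => [lS|Sl]; last first.
    by apply: big1 => ij _; rewrite coefCM nth_default ?mulr0 // (leq_trans _ Sl) //; case: (hw ij).
  move/ffunP/(_ (k, Ordinal lS)): e; rewrite !ffunE /= => /eqP; rewrite -subr_eq0 -sumrB => /eqP e.
  by rewrite -[RHS]e; apply: eq_bigr => ij _; rewrite coefCM mulrBl.
have DN : ev D ^+ (2 * N) != 0 by rewrite expf_neq0 ?transc.
apply: (mulfI DN); rewrite mulr0 pair_big /= mulr_sumr.
rewrite (eq_bigr (fun ij => \sum_k ev ((c ij - c' ij)%:P * w ij k) * b k)); last first.
  move=> [i j] _; rewrite mulrCA (hw (i, j)).2 mulr_sumr.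
  by apply: eq_bigr => k _; rewrite evM {2}/ev map_polyC hornerC mulrA.
rewrite exchange_big big1 // => k _.
by rewrite -mulr_suml -ev_sum zero /ev rmorph0 horner0 mul0r.
Qed.

End FunctionField.

Section Affine.
Variables (F : finFieldType) (K : fieldType) (iK : {rmorphism F -> K}).
Variables (A : comNzRingType) (iA : {rmorphism F -> A}) (jA : {rmorphism A -> K}).
Hypothesis K_function_field : function_field iK.
Hypothesis jA_inj : injective jA.
Hypothesis jA_iA : forall c, jA (iA c) = iK c.

(* In a relation sum_i a^i P_i(x) = 0 with i minimal such that P_i != 0, dividing
   by a^i shows that P_i(x) is a multiple of a. *)
Lemma polynomial_relation_mod (a x : A) : a != 0 ->
  exists2 p : {poly F}, p != 0 & exists y, (map_poly iA p).[x] = a * y.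
Proof.
move=> a0; have [t [transc [n [b gen]]]] := K_function_field.
have [N [c [[i [j cij]] e]]] := algebraic_dependence transc gen (jA a) (jA x).
(* Zero outside ['I_N], so that a least index with nonzero coefficient can be taken in nat. *)
pose P (i : nat) : {poly F} := \sum_(j < N) (if insub i is Some i then c i j else 0) *: 'X^j.
have Pi (k : 'I_N) : P k = \sum_(j < N) c k j *: 'X^j.
  by apply: eq_bigr => l _; rewrite valK.
have eA : \sum_(i < N) a ^+ i * (map_poly iA (P i)).[x] = 0.
  apply: jA_inj; rewrite rmorph0 -[RHS]e rmorph_sum; apply: eq_bigr => k _.
  rewrite Pi rmorphM rmorphXn [map_poly _ _]rmorph_sum horner_sum rmorph_sum mulr_sumr.
  apply: eq_bigr => l _; rewrite -mul_polyC rmorphM /= map_polyC map_polyXn.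
  by rewrite hornerM hornerC hornerXn rmorphM rmorphXn jA_iA mulrCA.
have exP : exists k, P k != 0.
  exists i; apply: contra cij => /eqP/(congr1 (fun p : {poly F} => p`_j)).
  rewrite Pi coef0 coef_sum (bigD1 j) //= coefZ coefXn eqxx mulr1 big1 ?addr0 => [->//|k kj].
  by rewrite coefZ coefXn val_eqE eq_sym (negPf kj) mulr0.
case: (ex_minnP exP) => k Pk minP; exists (P k) => //.
have aI u v : a * u = a * v -> u = v.
  move/(congr1 jA); rewrite !rmorphM => /mulfI h; apply: jA_inj; apply: h.
  by rewrite -(rmorph0 jA) (inj_eq jA_inj).
have akI u v : a ^+ k * u = a ^+ k * v -> u = v.
  by elim: k u v {Pk minP} => [|k IH] u v; rewrite ?mul1r // exprS -!mulrA => /aI/IH.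
have kN : (k < N)%N.
  case: (ltnP k N) => // Nk; case/eqP: Pk; apply: big1 => l _.
  by rewrite insubF ?scale0r //; apply/negbTE; rewrite -leqNgt.
exists (- \sum_(i < N | (k < i)%N) a ^+ (i - k.+1) * (map_poly iA (P i)).[x]).
apply: akI; rewrite mulrN mulrN; apply/eqP; rewrite -addr_eq0; apply/eqP.
rewrite -[RHS]eA [RHS](bigID (fun i : 'I_N => i <= k)%N) /=.
rewrite [X in _ = X + _](bigD1 (Ordinal kN)) //=.
rewrite [X in _ = _ + X + _]big1 ?addr0 => [|l /andP[lk nlk]]; last first.
  rewrite (_ : P l = 0) ?rmorph0 ?horner0 ?mulr0 //; apply/eqP; apply: contraTT isT => Pl /=.
  have := minP _ Pl; move: nlk; rewrite -val_eqE /= => nlk kl.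
  by case/eqP: nlk; apply/eqP; rewrite eqn_leq lk.
congr (_ + _); rewrite !mulr_sumr.
under [RHS]eq_bigl => l do rewrite -ltnNge.
apply: eq_bigr => l kl; rewrite !mulrA -exprSr -exprD subnKC //.
Qed.

Lemma powers_collide_mod_poly (p : {poly F}) : p != 0 ->
  exists i j, (i < j)%N /\ p %| 'X^i - 'X^j.
Proof.
move=> p0; pose f i : {ffun 'I_(size p) -> F} := [ffun k : 'I_(size p) => ('X^i %% p)`_k].
have [i [j [ij e]]] := finType_pigeonhole f.
exists i, j; split=> //; apply/modp_eq0P; rewrite modpD modpN; apply/polyP => k.
rewrite coefD coefN coef0; case: (ltnP k (size p)) => [kp|pk].
  by move/ffunP/(_ (Ordinal kp)): e; rewrite !ffunE => ->; rewrite subrr.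
have lt q : (size (q %% p)%R <= k)%N by apply: leq_trans pk; apply: ltnW; rewrite ltn_modp.
by rewrite !nth_default // subrr.
Qed.

(** The remainders of the X^i modulo a fixed nonzero polynomial are finite in number, so two of them
    coincide. In this form the algebraicity of A / l over F enters all later steps. *)
Lemma powers_collide_mod_ideal (l : set A) (x : A) :
  is_ideal l -> (exists2 a, l a & a != 0) ->
  exists i j, (i < j)%N /\ l (x ^+ i - x ^+ j).
Proof.
move=> [_ _ lM] [a la a0]; have [p p0 [y py]] := polynomial_relation_mod x a0.
have [i [j [ij /dvdpP[q e]]]] := powers_collide_mod_poly p0.
exists i, j; split=> //.
have -> : x ^+ i - x ^+ j = (map_poly iA ('X^i - 'X^j)).[x].
  by rewrite rmorphB /= !map_polyXn hornerD hornerN !hornerXn.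
by rewrite e rmorphM hornerM py mulrCA mulrC; exact: lM.
Qed.

End Affine.

(** * Frobenius systems over a local field *)

Section Valuation.
Variables (K : fieldType) (v : K -> int).
Hypothesis dv : discrete_valuation v.

(** The k-th power of the maximal ideal. For [k = 0] it is convertible to [valuation_ring v], so the
    lemmas below apply to that ring as well. *)
Definition valuation_ge (k : nat) : set K := [set x | x = 0 \/ k%:Z <= v x].

Let vM x y : x != 0 -> y != 0 -> v (x * y) = v x + v y.
Proof. by case: dv => _ h _; exact: h. Qed.

Lemma valuation1 : v 1 = 0.
Proof.
by apply: (addrI (v 1)); rewrite -vM ?oner_eq0 // mulr1 addr0.
Qed.

Lemma valuationN x : v (- x) = v x.
Proof.
have [->|x0] := eqVneq x 0; first by rewrite oppr0.
have N1 : (-1 : K) != 0 by rewrite oppr_eq0 oner_eq0.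
have /eqP : v (-1) *+ 2 = 0 by rewrite mulr2n -vM // mulrNN mulr1 valuation1.
by rewrite mulrn_eq0 /= => /eqP e; rewrite -mulN1r vM // e add0r.
Qed.

Lemma valuation_ge0 k : valuation_ge k 0. Proof. by left. Qed.

Lemma valuation_geD k x y :
  valuation_ge k x -> valuation_ge k y -> valuation_ge k (x + y).
Proof.
have [->|x0] := eqVneq x 0; first by rewrite add0r.
have [->|y0] := eqVneq y 0; first by rewrite addr0.
move=> [/eqP|hx]; first by rewrite (negPf x0).
move=> [/eqP|hy]; first by rewrite (negPf y0).
have [->|xy0] := eqVneq (x + y) 0; first by left.
case: dv => _ _ /(_ _ _ x0 y0 xy0) h; right; apply: le_trans h.
by rewrite le_min hx hy.
Qed.

Lemma valuation_geN k x : valuation_ge k x -> valuation_ge k (- x).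
Proof. by case=> [->|h]; [left; rewrite oppr0|right; rewrite valuationN]. Qed.

Lemma valuation_geB k x y :
  valuation_ge k x -> valuation_ge k y -> valuation_ge k (x - y).
Proof. by move=> hx /valuation_geN; exact: valuation_geD. Qed.

Lemma valuation_geM j k x y :
  valuation_ge j x -> valuation_ge k y -> valuation_ge (j + k) (x * y).
Proof.
have [->|x0] := eqVneq x 0; first by rewrite mul0r; left.
have [->|y0] := eqVneq y 0; first by rewrite mulr0; left.
move=> [/eqP|hx]; first by rewrite (negPf x0).
move=> [/eqP|hy]; first by rewrite (negPf y0).
by right; rewrite vM // PoszD lerD.
Qed.

Lemma valuation_geW j k x : (j <= k)%N -> valuation_ge k x -> valuation_ge j x.
Proof. by move=> le [->|h]; [left|right; apply: le_trans h; rewrite lez_nat]. Qed.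

Lemma valuation_ge_sum k (I : finType) (P : pred I) (f : I -> K) :
  (forall i, P i -> valuation_ge k (f i)) -> valuation_ge k (\sum_(i | P i) f i).
Proof.
by move=> h; apply: big_ind => //; [exact: valuation_ge0|exact: valuation_geD].
Qed.

Lemma valuation_geX k n x : valuation_ge k x -> valuation_ge (n * k) (x ^+ n).
Proof.
move=> h; elim: n => [|n IH]; first by right; rewrite mul0n expr0 valuation1.
by rewrite exprS mulSn; exact: valuation_geM.
Qed.

Lemma valuation_ge_eq0 x : (forall k, valuation_ge k x) -> x = 0.
Proof.
move=> h; case: (h `|v x|.+1) => // le.
by have := le_trans le (ler_norm _); rewrite -abszE lez_nat ltnn.
Qed.

Lemma valuation_ringM x y :
  valuation_ring v x -> valuation_ring v y -> valuation_ring v (x * y).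
Proof. exact: (@valuation_geM 0 0). Qed.

Lemma valuation_ring1 : valuation_ring v 1.
Proof. by right; rewrite valuation1. Qed.

Lemma complete_limit (u : nat -> K) : local_field v ->
  (forall n, valuation_ge n (u n.+1 - u n)) ->
  exists w, forall n, valuation_ge n (w - u n).
Proof.
move=> [_ complete _] hu.
have cauchy n m : (n <= m)%N -> valuation_ge n (u m - u n).
  move=> /subnKC <-; elim: (m - n)%N => [|k IH]; first by rewrite addn0 subrr; left.
  rewrite addnS -(subrKA (u (n + k)%N)); apply: valuation_geD => //.
  by apply: valuation_geW (hu _); rewrite leq_addr.
have cauchy2 n m m' : (n <= m)%N -> (n <= m')%N -> valuation_ge n (u m - u m').
  move=> h h'; rewrite -(subrKA (u n)); apply: valuation_geD; first exact: cauchy.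
  by rewrite -opprB; apply: valuation_geN; exact: cauchy.
have [N|w hw] := complete u.
  exists `|N|%N => m n hm hn.
  case: (cauchy2 _ _ _ hm hn) => [/eqP|h]; first by rewrite subr_eq0 => /eqP; left.
  by right; apply: le_trans h; rewrite abszE ler_norm.
exists w => n; have [n0 hn0] := hw n%:Z.
have h := hn0 (maxn n n0) (leq_maxr _ _).
rewrite -(subrKA (u (maxn n n0))); apply: valuation_geD; last first.
  by apply: cauchy; exact: leq_maxl.
by rewrite -opprB; apply: valuation_geN; case: h => [->|]; [rewrite subrr; left|right].
Qed.

End Valuation.

(** * Semilinear maps x |-> B x^(q) *)

Section FrobeniusLinear.
Variables (F : finFieldType) (L : fieldType) (iL : {rmorphism F -> L}).
Variables (N : nat) (B : 'M[L]_N).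

Definition frob_linear (x : 'cV[L]_N) : 'cV[L]_N := B *m map_mx (qfrob iL) x.

Lemma frob_linearD : {morph frob_linear : x y / x + y}.
Proof. by move=> x y; rewrite /frob_linear map_mxD mulmxDr. Qed.

Lemma frob_linearN : {morph frob_linear : x / - x}.
Proof. by move=> x; rewrite /frob_linear map_mxN mulmxN. Qed.

Lemma frob_linear0 : frob_linear 0 = 0.
Proof. by rewrite /frob_linear map_mx0 mulmx0. Qed.

Lemma frob_linearZ c x : frob_linear (c *: x) = c ^+ #|F| *: frob_linear x.
Proof. by rewrite /frob_linear map_mxZ scalemxAr. Qed.

Lemma iter_frob_linearD k : {morph iter k frob_linear : x y / x + y}.
Proof. by elim: k => [|k IH] x y //=; rewrite IH frob_linearD. Qed.

Lemma iter_frob_linearN k : {morph iter k frob_linear : x / - x}.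
Proof. by elim: k => [|k IH] x //=; rewrite IH frob_linearN. Qed.

(** By semilinearity this is the geometric sum of the Phi^j (w y), j < k; hence applying 1 - Phi
    telescopes. *)
Definition frob_sum k (w : L) (y : 'cV[L]_N) : 'cV[L]_N :=
  \sum_(j < k) w ^+ (#|F| ^ j) *: iter j frob_linear y.

Lemma frob_sum_telescope k w y :
  frob_sum k w y = frob_linear (frob_sum k w y)
    + w *: y - w ^+ (#|F| ^ k) *: iter k frob_linear y.
Proof.
elim: k => [|k IH].
  by rewrite /frob_sum big_ord0 frob_linear0 expn0 expr1 add0r subrr.
rewrite /frob_sum big_ord_recr -/(frob_sum k w y) /= frob_linearD.
rewrite frob_linearZ -exprM -expnSr {1}IH.
by rewrite subrK [_ + _ + w *: y]addrAC addrK.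
Qed.

End FrobeniusLinear.

Section FrobeniusLinearIntegral.
Variables (F : finFieldType) (K : fieldType) (iK : {rmorphism F -> K}) (v : K -> int).
Variables (N : nat) (B : 'M[K]_N).
Hypothesis K_local : local_field v.
Hypothesis B_int : forall i j, valuation_ring v (B i j).

Let dv : discrete_valuation v. Proof. by case: K_local. Qed.
Let Phi := frob_linear iK B.
Let ge k (x : 'cV[K]_N) := forall i, valuation_ge v k (x i 0).

Let q_gt1 : (1 < #|F|)%N. Proof. exact: card_finNzRing_gt1. Qed.

Lemma frob_linear_ge k x : ge k x -> ge (#|F| * k) (Phi x).
Proof.
move=> hx i; rewrite /Phi /frob_linear mxE; apply: valuation_ge_sum => // j _.
rewrite -[X in valuation_ge _ X]add0n; apply: (valuation_geM dv); first exact: B_int.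
by rewrite mxE; exact: (valuation_geX dv).
Qed.

Let geW j k x : (j <= k)%N -> ge k x -> ge j x.
Proof. by move=> le hx i; exact: valuation_geW le (hx i). Qed.

Let geD k x y : ge k x -> ge k y -> ge k (x + y).
Proof. by move=> hx hy i; rewrite mxE; exact: valuation_geD. Qed.

Let geN k x : ge k x -> ge k (- x).
Proof. by move=> hx i; rewrite mxE; exact: valuation_geN. Qed.

Let ge_iter k n x : ge k x -> ge k (iter n Phi x).
Proof.
elim: n => //= n IH /IH; move/frob_linear_ge; apply: geW.
by rewrite -{1}[k]mul1n leq_mul2r (ltnW q_gt1) orbT.
Qed.

Let ge1_iter n x : ge 1 x -> ge n (iter n Phi x).
Proof.
(* Strengthened by one: multiplying the bound by q gains nothing when the bound is 0. *)
move=> hx; suff : ge n.+1 (iter n Phi x) by apply: geW.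
elim: n => //= n /frob_linear_ge; apply: geW.
apply: (@leq_trans (2 * n.+1)); last by rewrite leq_mul2r q_gt1.
by rewrite mul2n -addnn addSn ltnS leq_addl.
Qed.

Let ge_eq0 x : (forall k, ge k x) -> x = 0.
Proof.
move=> h; apply/matrixP => i j; rewrite ord1 mxE; apply: (valuation_ge_eq0 (v := v)).
by move=> k; exact: h.
Qed.

(* E is the sum of the series P + Phi^m P + Phi^(2m) P + ... *)
Lemma frob_linear_fixpoint m (P : 'cV[K]_N) : (0 < m)%N -> ge 1 P ->
  exists2 E, ge 0 E & E = P + iter m Phi E.
Proof.
move=> m0 hP; pose u n := \sum_(k < n) iter (m * k) Phi P.
have uS n : u n.+1 = P + iter m Phi (u n).
  elim: n => [|n IH].
    rewrite /u big_ord1 big_ord0 muln0 /= (_ : iter m Phi 0 = 0) ?addr0 //.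
    by elim: (m) => //= k ->; exact: frob_linear0.
  rewrite {1}/u big_ord_recr /= -/(u n.+1) {1}IH.
  rewrite [u n.+1]big_ord_recr /= -/(u n) iter_frob_linearD addrA; congr (_ + _).
  by rewrite mulnS iterD.
have hu n : ge n (u n.+1 - u n).
  rewrite /u big_ord_recr /= addrAC subrr add0r; apply: geW (ge1_iter _ hP).
  by rewrite -{1}[n]mul1n leq_mul2r m0 orbT.
have /choice[w hw] : forall i, exists w, forall n, valuation_ge v n (w - u n i 0).
  move=> i; apply: complete_limit => // n.
  by have := hu n i; rewrite !mxE.
pose E : 'cV[K]_N := \col_i w i.
have hE n : ge n (E - u n) by move=> i; have := hw i n; rewrite !mxE.
exists E.
  have := hE 0%N; rewrite /u big_ord0 subr0; exact.
apply/eqP; rewrite -subr_eq0; apply/eqP/ge_eq0 => k.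
(* Both sides of the fixpoint equation are compared with the partial sums, which satisfy u (k+1) = P
   + Phi^m (u k). *)
have -> : E - (P + iter m Phi E) = (E - u k.+1) + - iter m Phi (E - u k).
  by rewrite iter_frob_linearD iter_frob_linearN uS opprB !opprD !addrA subrK.
apply: geD; last exact/geN/ge_iter/hE.
exact: geW (leqnSn k) (hE _).
Qed.

(** Modulo the maximal ideal only finitely many integral vectors remain, so the orbit repeats. Steps
    of length [m] are taken so that scalars with z^(q^m) = z stay fixed. *)
Lemma frob_linear_periodic (d : 'cV[K]_N) m : (0 < m)%N -> ge 0 d ->
  exists i k, (0 < k)%N /\
    ge 1 (iter (m * i) Phi d - iter (m * k) Phi (iter (m * i) Phi d)).
Proof.
move=> m0 hd; case: (K_local) => _ _ [s hs].
have /choice[a ha] : forall n, exists a : {ffun 'I_N -> 'I_(size s)},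
    forall i, valuation_ge v 1 (iter (m * n) Phi d i 0 - s`_(a i)).
  move=> n; suff /choice[a ha] : forall i, exists a : 'I_(size s),
      valuation_ge v 1 (iter (m * n) Phi d i 0 - s`_a).
    by exists (finfun a) => i; rewrite ffunE.
  move=> i; have [y ys h] := hs _ (ge_iter (m * n) hd i).
  rewrite -index_mem in ys; exists (Ordinal ys) => /=; rewrite nth_index -?index_mem //.
  by case: h => [->|h]; [rewrite subrr; left|right].
have [i [j [ij e]]] := finType_pigeonhole a.
exists i, (j - i)%N; split=> [|k]; first by rewrite subn_gt0.
rewrite -iterD -mulnDr subnK ?(ltnW ij) // !mxE -(subrKA (s`_(a i k))).
apply: valuation_geD => //; rewrite -opprB e.
exact: valuation_geN.
Qed.

End FrobeniusLinearIntegral.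

(** * Frobenius-periodic scalars and an Artin-Schreier equation *)

Section SeparableFrobenius.
Variables (F : finFieldType) (L : fieldType) (iL : {rmorphism F -> L}).
Local Notation q := #|F|.

Lemma expr_cardB n (x y : L) : (x - y) ^+ (q ^ n) = x ^+ (q ^ n) - y ^+ (q ^ n).
Proof.
elim: n => [|n IH]; first by rewrite !expn0 !expr1.
by rewrite expnSr !exprM IH -!/(qfrob iL _) rmorphB.
Qed.

Lemma expr_card_period n k (x : L) : x ^+ (q ^ n) = x -> x ^+ (q ^ (k * n)) = x.
Proof.
move=> e; elim: k => [|k IH]; first by rewrite expr1.
by rewrite mulSn expnD exprM e.
Qed.

Lemma card_natr_eq0 n : (0 < n)%N -> (q ^ n)%:R = 0 :> L.
Proof.
case: n => // n _; have [p p_pr chF] := finPcharP F.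
have := card_finNzRing_gt1 F; rewrite (card_pprimeChar chF) natrX exprS natrX.
case: (logn p q) => // k _; rewrite exprS -(rmorph_nat iL) (pcharf0 chF) rmorph0.
by rewrite !mul0r.
Qed.

(** The polynomial X^(q^n) - X + 1 has derivative -1, hence is separable. *)
Lemma artin_schreier_root n :
  (forall p : {poly L}, separable_poly p -> size p != 1%N -> exists x, root p x) ->
  (0 < n)%N -> exists c : L, c ^+ (q ^ n) = c - 1.
Proof.
move=> closed n0; have q1 : (1 < q)%N := card_finNzRing_gt1 F.
have qn1 : (1 < q ^ n)%N by rewrite -(exp1n n) ltn_exp2r.
pose p : {poly L} := 'X^(q ^ n) - ('X - 1).
have sp : size p = (q ^ n).+1.
  by rewrite size_polyDl size_polyXn // size_polyN size_XsubC.
have [||c] := closed p.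
- have -> : separable_poly p = coprimep p p^`() by rewrite separable_poly.unlock.
  have -> : p^`() = -1 *: 1.
    rewrite scaleN1r /p !derivB derivXn derivX derivC subr0 -mulr_natr.
    by rewrite -polyC_natr card_natr_eq0 // mulr0 sub0r.
  by rewrite coprimepZr ?coprimep1 // oppr_eq0 oner_eq0.
- by rewrite sp eqSS -lt0n ltnW.
by rewrite /root /p !hornerE subr_eq0 => /eqP e; exists c.
Qed.

(** Each n-fold Frobenius subtracts 1, and q = 0 in L, so q repetitions bring [c] back: [c] lies in
    a finite field. *)
Lemma artin_schreier_period n (c : L) : (0 < n)%N -> c ^+ (q ^ n) = c - 1 ->
  exists2 k, (0 < k)%N & c ^+ (q ^ (k * n)) = c.
Proof.
move=> n0 e; exists (q ^ 1)%N; first by rewrite expn1 (ltnW (card_finNzRing_gt1 F)).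
suff -> k : c ^+ (q ^ (k * n)) = c - k%:R by rewrite card_natr_eq0 // subr0.
elim: k => [|k IH]; first by rewrite subr0.
by rewrite mulSn expnD exprM e expr_cardB expr1n IH -natr1 opprD addrA.
Qed.

End SeparableFrobenius.

(** * Unramified integers and the action of inertia *)

Section Unramified.
Variables (F : finFieldType) (K : fieldType) (iK : {rmorphism F -> K}) (v : K -> int).
Variables (L : fieldType) (js : {rmorphism K -> L}).
Local Notation q := #|F|.

(** The elements algebraic over F: 0 and certain roots of unity. Positivity of [m] matters, since m
    = 0 would admit every x. *)
Definition root_of_frob (x : L) : Prop := exists2 m, (0 < m)%N & x ^+ (q ^ m) = x.

(* the valuation ring of the maximal unramified extension, as the subring
   generated by the valuation ring of K and the algebraic closure of F *)
Definition unramified : set L :=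
  [set u | exists s : seq (K * L),
     (forall z, z \in s -> valuation_ring v z.1 /\ root_of_frob z.2) /\
     u = \sum_(z <- s) js z.1 * z.2].

Lemma unramified0 : unramified 0.
Proof. by exists [::]; rewrite big_nil. Qed.

Lemma unramifiedD x y : unramified x -> unramified y -> unramified (x + y).
Proof.
move=> [s [hs ->]] [t [ht ->]]; exists (s ++ t); split; last by rewrite big_cat.
by move=> z; rewrite mem_cat => /orP[/hs|/ht].
Qed.

Lemma unramified_sum (I : finType) (P : pred I) (f : I -> L) :
  (forall i, P i -> unramified (f i)) -> unramified (\sum_(i | P i) f i).
Proof. by move=> h; apply: big_ind => //; [exact: unramified0|exact: unramifiedD]. Qed.

Lemma unramified_gen a x :
  valuation_ring v a -> root_of_frob x -> unramified (js a * x).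
Proof.
move=> ha hx; exists [:: (a, x)]; split; last by rewrite big_seq1.
by move=> z; rewrite inE => /eqP ->.
Qed.

Lemma unramified_ind (P : L -> Prop) : P 0 -> (forall x y, P x -> P y -> P (x + y)) ->
  (forall a x, valuation_ring v a -> root_of_frob x -> P (js a * x)) ->
  forall u, unramified u -> P u.
Proof.
move=> h0 hD hg u [s [hs ->]]; rewrite big_seq.
by apply: big_ind => // z /hs[]; exact: hg.
Qed.

Hypothesis dv : discrete_valuation v.

Lemma unramifiedZ a u : valuation_ring v a -> unramified u -> unramified (js a * u).
Proof.
move=> ha; move: u; apply: unramified_ind => [|x y hx hy|b x hb hx].
- by rewrite mulr0; exact: unramified0.
- by rewrite mulrDr; exact: unramifiedD.
by rewrite mulrA -rmorphM; apply: unramified_gen => //; exact: valuation_ringM.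
Qed.

Lemma unramifiedN u : unramified u -> unramified (- u).
Proof.
rewrite -mulN1r -(rmorph1 js) -rmorphN; apply: unramifiedZ.
exact/(@valuation_geN _ _ dv 0)/valuation_ring1.
Qed.

Lemma unramified_frob u : unramified u -> unramified (u ^+ q).
Proof.
rewrite -/(qfrob (js \o iK : {rmorphism F -> L}) u); move: u.
apply: unramified_ind => [|x y hx hy|b x hb [m m0 hx]].
- by rewrite rmorph0; exact: unramified0.
- by rewrite rmorphD; exact: unramifiedD.
rewrite /qfrob exprMn -rmorphXn; apply: unramified_gen.
  by rewrite -[_ ^+ _]mulr1; elim: q => [|k IH]; [rewrite mul1r; exact: valuation_ring1|
     rewrite exprS -mulrA; exact: valuation_ringM].
by exists m => //; rewrite exprAC hx.
Qed.

(** For x in a finite field, s x - x is again fixed by the same power of Frobenius. If nonzero it is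
    a root of unity, so its inverse is integral and it cannot lie in the maximal ideal. *)
Lemma unramified_inertia (s : galois_elt js) u : inertia v s -> unramified u -> s u = u.
Proof.
move=> hs; move: u; apply: unramified_ind => [|x y hx hy|a x ha [m m0 hx]].
- by rewrite rmorph0.
- by rewrite rmorphD hx hy.
rewrite rmorphM gal_fix; congr (_ * _).
have qm1 : (1 < q ^ m)%N by rewrite -(exp1n m) ltn_exp2r // card_finNzRing_gt1.
have int1 (y : L) n : (0 < n)%N -> y ^+ n = 1 -> integral_closure js v y.
  move=> n0 yn; exists ('X^n - 1%:P).
    split=> [|i]; first exact: monicXnsubC.
    rewrite coefB coefXn coefC; apply: (@valuation_geB _ _ dv 0).
      by case: (_ == _); [exact: valuation_ring1|left].
    by case: (_ == _); [exact: valuation_ring1|left].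
  by rewrite /root rmorphB /= map_polyXn map_polyC /= rmorph1 !hornerE yn subrr.
have unit (y : L) : y ^+ (q ^ m) = y -> y != 0 -> y ^+ (q ^ m).-1 = 1.
  by move=> e y0; apply: (mulfI y0); rewrite -exprS prednK ?(ltnW qm1) // mulr1.
have int (y : L) : y ^+ (q ^ m) = y -> integral_closure js v y.
  move=> e; have [->|y0] := eqVneq y 0.
    exists 'X; last by rewrite /root map_polyX hornerX.
    by split=> [|i]; [exact: monicX|rewrite coefX; case: (_ == _); [exact: valuation_ring1|left]].
  by apply: (int1 _ (q ^ m).-1); [case: (q ^ m)%N qm1 => // -[]|exact: unit].
have [_ []] := hs _ (int _ hx).
  by move/eqP; rewrite subr_eq0 => /eqP.
(* The inverse of 0 is 0 by convention, which is integral, so this case is contradictory too. *)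
have [->|y0] := eqVneq (s x - x) 0.
  by case; rewrite invr0; apply: int; rewrite expr0n gtn_eqF // ltnW.
case; apply: (int1 _ (q ^ m).-1); first by case: (q ^ m)%N qm1 => // -[].
rewrite exprVn unit ?invr1 //.
by rewrite (expr_cardB (js \o iK : {rmorphism F -> L})) -rmorphXn hx.
Qed.

End Unramified.

(** * Solving x = B x^(q) + d in unramified integers *)

Section UnramifiedLang.
Variables (F : finFieldType) (K : fieldType) (iK : {rmorphism F -> K}) (v : K -> int).
Variables (L : fieldType) (js : {rmorphism K -> L}).
Hypothesis K_local : local_field v.
Hypothesis js_closure : separable_closure js.
Local Notation q := #|F|.
Let iL : {rmorphism F -> L} := js \o iK.

Lemma map_frob_linear N (B : 'M[K]_N) j x :
  map_mx js (iter j (frob_linear iK B) x)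
  = iter j (frob_linear iL (map_mx js B)) (map_mx js x).
Proof.
elim: j => //= j IH; rewrite /frob_linear map_mxM; congr (_ *m _).
by rewrite -IH; apply/matrixP => a b; rewrite !mxE /qfrob rmorphXn.
Qed.

Lemma frob_sum_unramified N (B : 'M[K]_N) k (w : L) (y : 'cV[K]_N) :
  (forall i j, valuation_ring v (B i j)) -> (forall i, valuation_ring v (y i 0)) ->
  root_of_frob F w ->
  forall i, unramified F v js (frob_sum iL (map_mx js B) k w (map_mx js y) i 0).
Proof.
move=> hB hy [m m0 hw] i; rewrite summxE; apply: unramified_sum => j _.
rewrite -map_frob_linear !mxE mulrC; apply: unramified_gen; last first.
  by exists m => //; rewrite exprAC hw.
elim: (nat_of_ord j) i => //= {}j IH i.
by have := @frob_linear_ge _ _ iK _ _ _ K_local hB 0 _ IH i; rewrite muln0.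
Qed.

(* If Phi = B x^q has Phi^n y = y and c - c^(q^n) = 1, then x = sum_(j < n) c^(q^j) Phi^j y
   solves x - Phi x = y. Here the Phi-orbit of d is eventually periodic modulo the
   maximal ideal, and the error term is absorbed by a convergent series. *)
Lemma unramified_lang N (B : 'M[K]_N) (d : 'cV[K]_N) (z : L) :
  (forall i j, valuation_ring v (B i j)) -> (forall i, valuation_ring v (d i 0)) ->
  root_of_frob F z ->
  exists2 x : 'cV[L]_N, forall i, unramified F v js (x i 0) &
    x = frob_linear iL (map_mx js B) x + z *: map_mx js d.
Proof.
move=> hB hd [m m0 hz]; have [dv _ _] := K_local.
have zP : root_of_frob F z by exists m.
set Phi := frob_linear iK B; set PhiL := frob_linear iL (map_mx js B).
have [i [k [k0 hP]]] := frob_linear_periodic iK K_local hB m0 hd.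
set y := iter (m * i) Phi d in hP; set n := (m * k)%N in hP.
have n0 : (0 < n)%N by rewrite muln_gt0 m0.
have [c hc] := @artin_schreier_root F L iL n js_closure.2 n0.
have [k' k'0 hc'] := artin_schreier_period iL n0 hc.
have hw : ((c - 1) * z) ^+ (q ^ (k' * n)) = (c - 1) * z.
  by rewrite exprMn (expr_cardB iL) expr1n hc' mulnA mulnAC expr_card_period.
have M0 : (0 < k' * n)%N by rewrite muln_gt0 k'0.
have wP : root_of_frob F ((c - 1) * z) by exists (k' * n)%N.
have czP : root_of_frob F (c * z).
  exists (k' * n)%N => //; rewrite exprMn hc' mulnA mulnAC expr_card_period //.
(* The exponent k' n is a period of both c and z, so the scalar (c - 1) z passes through Phi^(k' n)
   unchanged. *)
have [E E0 hE] := frob_linear_fixpoint iK K_local hB M0 hP.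
have y0 j : valuation_ring v (y j 0).
  rewrite /y; elim: (m * i)%N j => //= l IH j.
  by have := @frob_linear_ge _ _ iK _ _ _ K_local hB 0 _ IH j; rewrite muln0.
(* Under 1 - Phi, [t1] gives z d - z y, [t2] gives c z y - (c - 1) z Phi^n y, and [t3] gives (c - 1)
   z (y - Phi^n y); hence t1 + t2 - t3 gives z d. *)
set t1 := frob_sum iL (map_mx js B) (m * i) z (map_mx js d).
set t2 := frob_sum iL (map_mx js B) n (c * z) (map_mx js y).
set t3 := frob_sum iL (map_mx js B) (k' * n) ((c - 1) * z) (map_mx js E).
exists (t1 + t2 - t3) => [j|].
  rewrite !mxE; apply: unramifiedD; last apply: unramifiedN => //.
    by apply: unramifiedD; apply: frob_sum_unramified.
  exact: frob_sum_unramified.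
have zX l : z ^+ (q ^ (m * l)) = z by rewrite mulnC expr_card_period.
have h1 : t1 = PhiL t1 + z *: map_mx js d - z *: map_mx js y.
  rewrite {1}/t1 frob_sum_telescope -map_frob_linear -/t1.
  by rewrite zX.
have h2 : t2 = PhiL t2 + (c * z) *: map_mx js y
               - ((c - 1) * z) *: map_mx js (iter n Phi y).
  rewrite {1}/t2 frob_sum_telescope -map_frob_linear -/t2 exprMn hc.
  by rewrite zX.
have h3 : t3 = PhiL t3 + ((c - 1) * z) *: (map_mx js y - map_mx js (iter n Phi y)).
  rewrite {1}/t3 frob_sum_telescope -map_frob_linear -/t3 hw -addrA -scalerBr.
  by rewrite -!map_mxB {1}hE addrK.
rewrite {1}h1 {1}h2 {1}h3 /PhiL !frob_linearD frob_linearN.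
by apply/matrixP => a b; rewrite !mxE; ring.
Qed.

End UnramifiedLang.

(** * Lang's theorem over A (x) O_p, modulo powers of l and in the completion *)

Section IdealPowSmall.
Variables (R : comPzRingType) (J : set R).

Lemma ideal_pow0T x : ideal_pow setT J 0 x.
Proof.
exists [:: (x, 1)]; split; last by rewrite big_seq1 [_ *: _]mulr1.
move=> z; rewrite inE => /eqP -> /=; split=> //; exists (fun i => 0); first by case.
by rewrite big_ord0.
Qed.

Lemma ideal_pow1 x : J x -> ideal_pow setT J 1 x.
Proof.
move=> Jx; exists [:: (1, x)]; split; last by rewrite big_seq1 [_ *: _]mul1r.
move=> z; rewrite inE => /eqP -> /=; split=> //; exists (fun i => x) => //.
by rewrite big_ord1.
Qed.

End IdealPowSmall.

(** * Filtration of integral tensors by powers of l *)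

Section Tensors.
Variables (F : finFieldType) (A : comNzRingType) (iA : {rmorphism F -> A}).
Variables (Fp : fieldType) (iF : {rmorphism F -> Fp}) (v : Fp -> int).
Variables (Fs : fieldType) (js : {rmorphism Fp -> Fs}) (l : set A).
Hypothesis Fp_local : local_field v.
Let dv : discrete_valuation v. Proof. by case: Fp_local. Qed.

Local Notation pow := (ideal_pow setT l).
Local Notation trF := (tr iA iF).
Local Notation trS := (tr iA (js \o iF : {rmorphism F -> Fs})).
Local Notation AFS := (AFS iA iF js).
Local Notation tauS := (tauS iA iF js).
Local Notation unramified := (unramified F v js).

(** Smallness is recorded in the A-factor and integrality in the other; an ideal power of the tensor
    ring would lose the latter. [l_unramified] plays the same role over [Fs]. *)
Definition l_integral (n : nat) : set (AF iA iF) :=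
  [set x | exists s : seq (A * Fp),
     (forall z, z \in s -> pow n z.1 /\ valuation_ring v z.2) /\
     x = \sum_(z <- s) trF z.1 z.2].

Definition l_unramified (n : nat) : set (AS iA iF js) :=
  [set x | exists s : seq (A * Fs),
     (forall z, z \in s -> pow n z.1 /\ unramified z.2) /\
     x = \sum_(z <- s) trS z.1 z.2].

Lemma tensor_r0 a : trS a 0 = 0.
Proof. by apply: (addrI (trS a 0)); rewrite -trDr !addr0. Qed.

Lemma tensor_l0 a : trS 0 a = 0.
Proof. by apply: (addrI (trS 0 a)); rewrite -trDl !addr0. Qed.

Lemma tensor_lN x a : trS (- x) a = - trS x a.
Proof. by apply/eqP; rewrite -addr_eq0 -trDl addNr tensor_l0. Qed.

Lemma tensor_r_sum (I : finType) a (f : I -> Fs) :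
  trS a (\sum_i f i) = \sum_i trS a (f i).
Proof. exact: (big_morph (trS a) (trDr _ _ a) (tensor_r0 a)). Qed.

Lemma AFS_tr a f : AFS (trF a f) = trS a (js f).
Proof. exact: tring_mapE. Qed.

Lemma tauS_tr a u : tauS (trS a u) = trS a (u ^+ #|F|).
Proof. exact: tring_mapE. Qed.

Lemma l_unramified0 n : l_unramified n 0.
Proof. by exists [::]; rewrite big_nil. Qed.

Lemma l_unramifiedD n x y :
  l_unramified n x -> l_unramified n y -> l_unramified n (x + y).
Proof.
move=> [s [hs ->]] [t [ht ->]]; exists (s ++ t); split; last by rewrite big_cat.
by move=> z; rewrite mem_cat => /orP[/hs|/ht].
Qed.

Lemma l_unramified_sum n (I : finType) (P : pred I) f :
  (forall i, P i -> l_unramified n (f i)) -> l_unramified n (\sum_(i | P i) f i).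
Proof.
by move=> h; apply: big_ind => //; [exact: l_unramified0|exact: l_unramifiedD].
Qed.

Lemma l_unramified_gen n a u :
  pow n a -> unramified u -> l_unramified n (trS a u).
Proof.
move=> ha hu; exists [:: (a, u)]; split; last by rewrite big_seq1.
by move=> z; rewrite inE => /eqP ->.
Qed.

Lemma l_unramified_ind n (P : AS iA iF js -> Prop) :
  P 0 -> (forall x y, P x -> P y -> P (x + y)) ->
  (forall a u, pow n a -> unramified u -> P (trS a u)) ->
  forall x, l_unramified n x -> P x.
Proof.
move=> h0 hD hg x [s [hs ->]]; rewrite big_seq.
by apply: big_ind => // z /hs[]; exact: hg.
Qed.

Lemma l_unramifiedN n x : l_unramified n x -> l_unramified n (- x).
Proof.
move: x; apply: l_unramified_ind => [|x y hx hy|a u ha hu].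
- by rewrite oppr0; exact: l_unramified0.
- by rewrite opprD; exact: l_unramifiedD.
by rewrite -tensor_lN; apply: l_unramified_gen => //; exact: powN.
Qed.

Lemma l_unramifiedM m n x y :
  l_integral m x -> l_unramified n y -> l_unramified (m + n) (AFS x * y).
Proof.
move=> [s [hs ->]] hy; rewrite big_seq rmorph_sum mulr_suml.
apply: big_ind => [||[a f] /hs[/= ha hf]]; [exact: l_unramified0|exact: l_unramifiedD|].
rewrite AFS_tr; move: y hy; apply: l_unramified_ind => [|y z hy hz|b u hb hu].
- by rewrite mulr0; exact: l_unramified0.
- by rewrite mulrDr; exact: l_unramifiedD.
rewrite trM; apply: l_unramified_gen; first exact: pow_mul.
exact: unramifiedZ.
Qed.

Lemma AO_l_integral x : AO v x -> l_integral 0 x.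
Proof.
by move=> [s [hs ->]]; exists s; split=> // z /hs h; split=> //; exact: ideal_pow0T.
Qed.

Lemma l_unramified_pow n x : l_unramified n x -> ideal_pow setT (lS l) n x.
Proof.
move: x; apply: l_unramified_ind => [|x y|a u ha _]; [exact: pow0|exact: powD|].
move: a ha; apply: (@span_min A A^o) => [|a b ha hb|c a ha|a [b hb ->]].
- by rewrite tensor_l0; exact: pow0.
- by rewrite trDl; exact: powD.
- have -> : trS (c *: a) u = trS c 1 * trS a u by rewrite trM mul1r.
  exact: powM.
have -> : trS (\prod_i b i) u = trS 1 u * \prod_i trS (b i) 1.
  have -> : \prod_i trS (b i) 1 = trS (\prod_i b i) 1.
    by rewrite (big_morph (fun a => trS a 1) (id1 := 1) (op1 := *%R)) // => x y; rewrite trM mulr1.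
  by rewrite trM mul1r mulr1.
apply: powM; apply: (@span_gen _ _); exists (fun i => trS (b i) 1) => // i.
by apply: span_gen; exists (b i).
Qed.

Lemma l_unramified_inertia (s : galois_elt js) n x :
  inertia v s -> l_unramified n x -> galS iA iF s x = x.
Proof.
move=> hs; move: x; apply: l_unramified_ind => [|x y hx hy|a u _ hu].
- by rewrite rmorph0.
- by rewrite rmorphD hx hy.
by rewrite [LHS]tring_mapE (unramified_inertia iF dv hs hu).
Qed.

End Tensors.

(** * One step from l^n to l^(n+1) *)

Section LangStep.
Variables (F : finFieldType) (A : comNzRingType) (iA : {rmorphism F -> A}).
Variables (Fp : fieldType) (iF : {rmorphism F -> Fp}) (v : Fp -> int).
Variables (Fs : fieldType) (js : {rmorphism Fp -> Fs}) (l : set A).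
Hypothesis Fp_local : local_field v.
Hypothesis Fs_closure : separable_closure js.
Hypothesis l_collide : forall x, exists i j, (i < j)%N /\ l (x ^+ i - x ^+ j).
Let dv : discrete_valuation v. Proof. by case: Fp_local. Qed.

Local Notation q := #|F|.
Local Notation pow := (ideal_pow setT l).
Local Notation trF := (tr iA iF).
Local Notation trS := (tr iA (js \o iF : {rmorphism F -> Fs})).
Local Notation AFS := (AFS iA iF js).
Local Notation tauS := (tauS iA iF js).
Local Notation unramified := (unramified F v js).
Local Notation l_unramified := (@l_unramified F A iA Fp iF v Fs js l).

(** Replaces a finite-dimensional subspace of l^n / l^(n+1) stable under X. Adjoining the multiples
    x^e g with e < j suffices for x, because x^j = x^i modulo l; stability under earlier elements
    survives multiplication by x^e. *)
Lemma pow_stable_family n (X Y : seq A) : (forall y, y \in Y -> pow n y) ->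
  exists2 G : seq A, (forall g, g \in G -> pow n g) /\ {subset Y <= G} &
    forall x g, x \in X -> g \in G -> exists2 h, h \in G & pow n.+1 (x * g - h).
Proof.
move=> hY; elim: X => [|x X [G [hG YG] GX]]; first by exists Y; [split|].
have [i [j [ij lij]]] := l_collide x.
exists [seq x ^+ e * g | e <- iota 0 j, g <- G].
  split=> [_ /allpairsP[[e g] /= [_ /hG hg ->]]|g /YG hg]; first exact: powM.
  apply/allpairsP; exists (0%N, g); split=> //=; last by rewrite mul1r.
  by rewrite mem_iota /= (leq_trans _ ij).
move=> y ?; rewrite inE => /orP[/eqP ->|yX] /allpairsP[[e g] /= [he hg ->]]; last first.
  have [h hG' hh] := GX _ _ yX hg; exists (x ^+ e * h); last first.
    by rewrite mulrCA -mulrBr; exact: powM.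
  by apply/allpairsP; exists (e, h).
move: he; rewrite mem_iota add0n /= leq_eqVlt => /orP[/eqP ej|ej].
  exists (x ^+ i * g).
    by apply/allpairsP; exists (i, g); rewrite mem_iota.
  rewrite mulrA -exprS ej -mulrBl -opprB mulNr; apply: powN.
  by rewrite -[n.+1]add1n; apply: pow_mul; [exact: ideal_pow1|exact: hG].
exists (x ^+ e.+1 * g).
  by apply/allpairsP; exists (e.+1, g); rewrite mem_iota.
by rewrite mulrA -exprS subrr; exact: pow0.
Qed.

(** Solutions add up with their right-hand sides, so it is enough to treat a z times a unit vector,
    with a in O_p and z fixed by a power of Frobenius. *)
Lemma unramified_lang_family (J : finType) (b : J -> J -> Fp) (d : J -> Fs) :
  (forall i j, valuation_ring v (b i j)) -> (forall i, unramified (d i)) ->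
  exists2 x : J -> Fs, forall i, unramified (x i) &
    forall i, x i = \sum_j js (b i j) * x j ^+ q + d i.
Proof.
move=> hb hd; pose B : 'M[Fp]_#|J| := \matrix_(i, j) b (enum_val i) (enum_val j).
have hB i j : valuation_ring v (B i j) by rewrite mxE.
pose iS : {rmorphism F -> Fs} := js \o iF.
pose solvable D := exists2 x : 'cV[Fs]_#|J|, forall i, unramified (x i 0) &
  x = frob_linear iS (map_mx js B) x + D.
have sol0 : solvable 0.
  exists 0 => [i|]; first by rewrite mxE; exact: unramified0.
  by rewrite frob_linear0 addr0.
have solD D D' : solvable D -> solvable D' -> solvable (D + D').
  move=> [x hx ex] [y hy ey]; exists (x + y) => [i|].
    by rewrite mxE; exact: unramifiedD.
  by rewrite frob_linearD addrACA -ex -ey.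
have [x hx ex] : solvable (\col_i d (enum_val i)).
  rewrite [\col__ _]matrix_sum_delta; apply: big_ind => // i _.
  apply: big_ind => // j _; rewrite mxE; move: (d _) (hd (enum_val i)).
  apply: unramified_ind => [|x y sx sy|a z ha hz]; first by rewrite scale0r.
    by rewrite scalerDl; exact: solD.
  have [|x hx ex] := unramified_lang iF Fp_local Fs_closure (d := a *: delta_mx i j) hB _ hz.
    move=> k; rewrite !mxE; case: (_ && _); first by rewrite mulr1.
    by rewrite mulr0; left.
  by exists x => //; rewrite {1}ex map_mxZ map_delta_mx scalerA mulrC.
exists (fun i => x (enum_rank i) 0) => // i; rewrite {1}ex !mxE enum_rankK.
congr (_ + _); rewrite [RHS](reindex (@enum_val J J)) /=; last first.
  by exists enum_rank => k _; rewrite ?enum_rankK ?enum_valK.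
by apply: eq_bigr => k _; rewrite !mxE enum_rankK enum_valK.
Qed.

(* The equation delta - B tau(delta) = d is linear over the residues modulo l^(n+1), and
   on a finite family of generators stable under the coefficients of B it becomes a
   q-Frobenius system over Fs. *)
Lemma l_unramified_lang n r (B : 'I_r -> 'I_r -> AF iA iF) (d : 'I_r -> AS iA iF js) :
  (forall i j, AO v (B i j)) -> (forall i, l_unramified n (d i)) ->
  exists2 x : 'I_r -> AS iA iF js, forall i, l_unramified n (x i) &
    forall i, l_unramified n.+1 (x i - \sum_j AFS (B i j) * tauS (x j) - d i).
Proof.
move=> hB hd.
have /choice[sB hsB] : forall ij : 'I_r * 'I_r, exists s : seq (A * Fp),
    (forall z, z \in s -> valuation_ring v z.2) /\
    B ij.1 ij.2 = \sum_(z <- s) trF z.1 z.2 by case=> i j; exact: hB.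
have /choice[sd hsd] := hd.
pose X := flatten [seq [seq z.1 | z <- sB ij] | ij <- enum {: 'I_r * 'I_r}].
pose Y := flatten [seq [seq z.1 | z <- sd i] | i <- enum 'I_r].
have hY y : y \in Y -> pow n y.
  by case/flatten_mapP => i _ /mapP[z hz ->]; case: (hsd i) => /(_ z hz)[].
have [G [hG YG] GX] := pow_stable_family X hY.
pose g (k : 'I_(size G)) := G`_k.
have gP k : pow n (g k) by apply: hG; exact: mem_nth.
have gE y : y \in G -> exists k, y = g k.
  by rewrite -index_mem => h; exists (Ordinal h); rewrite /g /= nth_index -?index_mem.
(* The coefficients of multiplication by [B i j] on the family G, valid modulo l^(n+1) and uniformly
   in the unramified factor [u]. *)
have /choice[b hb] : forall ijk : 'I_r * 'I_r * 'I_(size G),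
    exists b : 'I_(size G) -> Fp, (forall h, valuation_ring v (b h)) /\
    forall u, unramified u ->
      l_unramified n.+1 (AFS (B ijk.1.1 ijk.1.2) * trS (g ijk.2) u
                         - \sum_h trS (g h) (js (b h) * u)).
  move=> [ij k] /=; have [hs ->] := hsB ij.
  have : {subset [seq z.1 | z <- sB ij] <= X}.
    by move=> a ha; apply/flatten_mapP; exists ij => //; rewrite mem_enum.
  elim: (sB ij) hs => [|[a f] s IH] hs sX.
    exists (fun=> 0); split=> [h|u _]; first by left.
    rewrite big_nil rmorph0 mul0r sub0r big1 ?oppr0; first exact: l_unramified0.
    by move=> h _; rewrite rmorph0 mul0r tensor_r0.
  have [||b [hb eb]] := IH.
  - by move=> z hz; apply: hs; rewrite inE hz orbT.
  - by move=> z hz; apply: sX; rewrite inE hz orbT.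
  have [|y /gE[m ->] ym] := GX a (g k) _ (mem_nth _ (ltn_ord k)).
    by apply: sX; rewrite inE eqxx.
  have hf : valuation_ring v f by apply: (hs (a, f)); rewrite inE eqxx.
  exists (fun h => (if h == m then f else 0) + b h); split=> [h|u hu].
    apply: (@valuation_geD _ _ dv 0); last exact: hb.
    by case: (h == m); [exact: hf|left].
  have -> : \sum_h trS (g h) (js ((if h == m then f else 0) + b h) * u)
          = trS (g m) (js f * u) + \sum_h trS (g h) (js (b h) * u).
    rewrite [in RHS](bigD1 m) //= addrA -trDr -mulrDl -rmorphD (bigD1 m) //= eqxx.
    by congr (_ + _); apply: eq_bigr => h /negPf ->; rewrite add0r.
  rewrite big_cons /= rmorphD mulrDl AFS_tr trM opprD addrACA.
  apply: l_unramifiedD; last exact: eb.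
  rewrite -tensor_lN -trDl; apply: l_unramified_gen => //; exact: unramifiedZ.
have /choice[u hu] : forall i, exists u : 'I_(size G) -> Fs,
    (forall k, unramified (u k)) /\ d i = \sum_k trS (g k) (u k).
  move=> i; have [hs ->] := hsd i.
  have : {subset [seq z.1 | z <- sd i] <= Y}.
    by move=> a ha; apply/flatten_mapP; exists i => //; rewrite mem_enum.
  elim: (sd i) hs => [|[a w] s IH] hs sY.
    exists (fun=> 0); split=> [k|]; first exact: unramified0.
    by rewrite big_nil big1 // => k _; rewrite tensor_r0.
  have [||u [hu eu]] := IH.
  - by move=> z hz; apply: hs; rewrite inE hz orbT.
  - by move=> z hz; apply: sY; rewrite inE hz orbT.
  have [m am] : exists m, a = g m by apply/gE/YG/sY; rewrite inE eqxx.
  have hw : unramified w by case: (hs (a, w)); rewrite ?inE ?eqxx.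
  exists (fun k => (if k == m then w else 0) + u k); split=> [k|].
    by apply: unramifiedD => //; case: (k == m) => //; exact: unramified0.
  rewrite big_cons /= eu am [in LHS](bigD1 m) //= [in RHS](bigD1 m) //= eqxx addrA -trDr.
  by congr (_ + _); apply: eq_bigr => k /negPf ->; rewrite add0r.
pose b' (ik jh : 'I_r * 'I_(size G)) := b (ik.1, jh.1, jh.2) ik.2.
have [|[i k]|x hx ex] := @unramified_lang_family _ b' (fun ik => u ik.1 ik.2).
- by move=> ik jh; apply: (hb (ik.1, jh.1, jh.2)).1.
- exact: (hu i).1.
exists (fun i => \sum_k trS (g k) (x (i, k))) => i.
  by apply: l_unramified_sum => k _; apply: l_unramified_gen.
(* [y] is the actual product and [z] its expansion in G; x solves the system for [z] exactly, so
   only the differences y - z remain. *)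
pose y j k := AFS (B i j) * trS (g k) (x (j, k) ^+ q).
pose z j k := \sum_h trS (g h) (js (b (i, j, k) h) * x (j, k) ^+ q).
have -> : \sum_j AFS (B i j) * tauS (\sum_k trS (g k) (x (j, k))) = \sum_j \sum_k y j k.
  apply: eq_bigr => j _; rewrite rmorph_sum mulr_sumr.
  by apply: eq_bigr => k _; rewrite tauS_tr.
have -> : \sum_k trS (g k) (x (i, k)) = \sum_j \sum_k z j k + d i.
  rewrite (hu i).2 pair_bigA /= exchange_big -big_split; apply: eq_bigr => k _ /=.
  by rewrite ex trDr tensor_r_sum; congr (_ + _); apply: eq_bigr => -[].
rewrite -addrA addrCA addrK addrC; rewrite -opprB; apply: l_unramifiedN => //.
rewrite -sumrB; apply: l_unramified_sum => j _; rewrite -sumrB.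
apply: l_unramified_sum => k _; apply: (hb (i, j, k)).2.
exact: unramified_frob.
Qed.

End LangStep.

Lemma ccls_sum (R : comPzRingType) (L : set R) (I : Type) (r : seq I)
    (s : I -> cohseq L) :
  exists2 t : cohseq L, forall n, t n = \sum_(i <- r) s i n &
    \sum_(i <- r) ccls (s i) = ccls t.
Proof.
elim: r => [|i r [t ht et]].
  by exists (cconst L 0) => [n|]; rewrite big_nil.
exists (csadd (s i) t) => [n|]; first by rewrite big_cons /= ht.
by rewrite big_cons et [LHS]caddE.
Qed.

(** * Successive approximation in the completion *)

Section CompletionLang.
Variables (F : finFieldType) (A : comNzRingType) (iA : {rmorphism F -> A}).
Variables (Fp : fieldType) (iF : {rmorphism F -> Fp}) (v : Fp -> int).
Variables (Fs : fieldType) (js : {rmorphism Fp -> Fs}) (l : set A).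
Hypothesis Fp_local : local_field v.
Hypothesis Fs_closure : separable_closure js.
Hypothesis l_collide : forall x, exists i j, (i < j)%N /\ l (x ^+ i - x ^+ j).
Let dv : discrete_valuation v. Proof. by case: Fp_local. Qed.

Local Notation AFS := (AFS iA iF js).
Local Notation tauS := (tauS iA iF js).
Local Notation AFl := (AFl iA iF js l).
Local Notation tauAl := (tauAl iA iF js l).
Local Notation l_unramified := (@l_unramified F A iA Fp iF v Fs js l).
Local Notation l_integral := (@l_integral F A iA Fp iF v l).

Variable y : AF iA iF.
Hypothesis y1 : l_integral 1 (1 - y).

Lemma l_integral_unramified n x : l_integral n x -> l_unramified n (AFS x).
Proof.
move=> hx; rewrite -[AFS x]mulr1 -[n]addn0; apply: l_unramifiedM => //.
apply: l_unramified_gen; first exact: ideal_pow0T.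
rewrite -(mulr1 1) -{1}(rmorph1 js); apply: unramified_gen.
  exact: valuation_ring1.
by exists 1%N => //; rewrite expr1n.
Qed.

(** The inverse is the geometric series in 1 - y, which is l-adically small. *)
Lemma AFl_unit : exists y', y' * AFl y = 1.
Proof.
pose t := AFS (1 - y).
have ht n : ideal_pow setT (lS l) n (t ^+ n).
  elim: n => [|n IH]; first exact: ideal_pow0T.
  rewrite exprS -add1n; apply: pow_mul => //.
  exact/(l_unramified_pow (v := v))/l_integral_unramified.
have hu n : ideal_pow setT (lS l) n (\sum_(k < n.+1) t ^+ k - \sum_(k < n) t ^+ k).
  by rewrite big_ord_recr /= addrAC subrr add0r.
exists (ccls (CohSeq hu)).
rewrite [LHS]cmulE; apply: ccls_eq => n /=.
have -> : AFS y = 1 - t by rewrite /t rmorphB rmorph1 opprB addrC subrK.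
have -> : (\sum_(k < n) t ^+ k) * (1 - t) - 1 = - t ^+ n.
  by rewrite mulrC -[1 - t]opprB mulNr -subrX1; ring.
exact: powN.
Qed.

Section Solve.
Variables (r : nat) (B : 'I_r -> 'I_r -> AF iA iF) (m : 'I_r -> AF iA iF).
Hypothesis B_int : forall i j, AO v (B i j).
Hypothesis m_int : forall i, AO v (m i).

Let residual (a : 'I_r -> AS iA iF js) i :=
  AFS y * a i - \sum_j AFS (B i j) * tauS (a j) - AFS (m i).

Let good n a := forall i, l_unramified 0 (a i) /\ l_unramified n (residual a i).

(** The hypothesis stands under the existential so that [choice] yields a function on all pairs,
    which can then be iterated. *)
Let refine n a : exists a', good n a ->
  good n.+1 a' /\ forall i, l_unramified n (a' i - a i).
Proof.
have [ga|nga] := pselect (good n a); last by exists a.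
have [|d hd ed] := @l_unramified_lang F A iA Fp iF v Fs js l Fp_local Fs_closure l_collide
  n r B (fun i => - residual a i) B_int.
  by move=> i /=; apply: l_unramifiedN; case: (ga i).
exists (fun i => a i + d i) => _; split=> i; last by rewrite addrAC subrr add0r.
split.
  apply: l_unramifiedD; first by case: (ga i).
  move: (d i) (hd i); apply: l_unramified_ind => [|x z|x u _ hu].
  - exact: l_unramified0.
  - exact: l_unramifiedD.
  by apply: l_unramified_gen => //; exact: ideal_pow0T.
(* The correction was found with y replaced by 1; the error (1 - y) d lies one step deeper in the
   filtration. *)
have -> : residual (fun i => a i + d i) i
  = (d i - \sum_j AFS (B i j) * tauS (d j) - - residual a i) - AFS (1 - y) * d i.
  rewrite /residual rmorphB rmorph1.
  under eq_bigr => j _ do rewrite rmorphD mulrDr.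
  rewrite big_split /=; ring.
apply: l_unramifiedD; first exact: ed.
by apply: l_unramifiedN; rewrite -add1n; apply: l_unramifiedM.
Qed.

Lemma completion_lang : exists2 a : 'I_r -> Al iA iF js l,
  forall i, AFl y * a i = \sum_j AFl (B i j) * tauAl (a j) + AFl (m i) &
  forall s, inertia v s -> forall i, galAl iA iF l s (a i) = a i.
Proof.
have /choice[f hf] : forall na : nat * ('I_r -> AS iA iF js), exists a', good na.1 na.2 ->
    good na.1.+1 a' /\ forall i, l_unramified na.1 (a' i - na.2 i).
  by move=> [n a]; exact: refine.
(* Starting at 0 is allowed: at level 0 the condition on the residual is mere integrality, which
   holds for - m. *)
pose u := fix u n := if n is n.+1 then f (n, u n) else fun=> 0.
have gu n : good n (u n).
  elim: n => [|n IH] /=; last exact: (hf (n, u n) IH).1.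
  move=> i; split; first exact: l_unramified0.
  rewrite /residual mulr0 sub0r big1 ?oppr0 ?sub0r => [|j _]; last by rewrite rmorph0 mulr0.
  apply: l_unramifiedN; exact/l_integral_unramified/AO_l_integral.
have du i n : ideal_pow setT (lS l) n (u n.+1 i - u n i).
  by apply: (l_unramified_pow (v := v)); exact: (hf (n, u n) (gu n)).2.
pose a i := CohSeq (du i).
exists (fun i => ccls (a i)) => [i|s hs i]; last first.
  rewrite [LHS]cmapE; apply: ccls_ext => n /=.
  exact: (l_unramified_inertia Fp_local hs (gu n i).1).
have -> : \sum_j AFl (B i j) * tauAl (ccls (a j))
       = \sum_j ccls (csmul (cconst _ (AFS (B i j))) (csmap (@tauS_l _ _ _ _ _ _ _ l) (a j))).
  by apply: eq_bigr => j _; rewrite [tauAl _]cmapE [LHS]cmulE.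
have [t ht ->] := ccls_sum (index_enum 'I_r) (fun j => csmul (cconst _ (AFS (B i j)))
  (csmap (@tauS_l _ _ _ _ _ _ _ l) (a j))).
rewrite [LHS]cmulE [RHS]caddE; apply: ccls_eq => n /=.
rewrite ht opprD addrA; apply: (l_unramified_pow (v := v)).
exact: (gu n i).2.
Qed.

End Solve.

End CompletionLang.

(** * Models and Tate modules *)

Section IntegralTensors.
Variables (F : finFieldType) (A : comNzRingType) (iA : {rmorphism F -> A}).
Variables (Fp : fieldType) (iF : {rmorphism F -> Fp}) (v : Fp -> int) (l : set A).
Hypothesis dv : discrete_valuation v.

Local Notation AO := (@AO F A iA Fp iF v).
Local Notation trF := (tr iA iF).
Local Notation l_integral := (@l_integral F A iA Fp iF v l).

Lemma AO_tr a f : valuation_ring v f -> AO (trF a f).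
Proof.
move=> hf; exists [:: (a, f)]; split; last by rewrite big_seq1.
by move=> z; rewrite inE => /eqP ->.
Qed.

Lemma AOD x y : AO x -> AO y -> AO (x + y).
Proof.
move=> [s [hs ->]] [t [ht ->]]; exists (s ++ t); split; last by rewrite big_cat.
by move=> z; rewrite mem_cat => /orP[/hs|/ht].
Qed.

Lemma AO0 : AO 0.
Proof. by exists [::]; rewrite big_nil. Qed.

Lemma l_integralD n x y : l_integral n x -> l_integral n y -> l_integral n (x + y).
Proof.
move=> [s [hs ->]] [t [ht ->]]; exists (s ++ t); split; last by rewrite big_cat.
by move=> z; rewrite mem_cat => /orP[/hs|/ht].
Qed.

Lemma l_integral0 n : l_integral n 0.
Proof. by exists [::]; rewrite big_nil. Qed.

Lemma l_integral_AO n x : l_integral n x -> AO x.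
Proof. by move=> [s [hs ->]]; exists s; split=> // z /hs[]. Qed.

Lemma l_integralM n x y : AO x -> l_integral n y -> l_integral n (x * y).
Proof.
move=> [s [hs ->]] [t [ht ->]]; rewrite big_seq mulr_suml.
apply: big_ind => [||[a f] /hs /= hf]; [exact: l_integral0|exact: l_integralD|].
rewrite big_seq mulr_sumr.
apply: big_ind => [||[b g] /ht /= [hb hg]]; [exact: l_integral0|exact: l_integralD|].
rewrite trM; exists [:: (a * b, f * g)]; split; last by rewrite big_seq1.
by move=> z; rewrite inE => /eqP -> /=; split; [exact: powM|exact: valuation_ringM].
Qed.

Lemma AOM x y : AO x -> AO y -> AO (x * y).
Proof.
move=> [s [hs ->]] [t [ht ->]]; rewrite big_seq mulr_suml.
apply: big_ind => [||[a f] /hs /= hf]; [exact: AO0|exact: AOD|].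
rewrite big_seq mulr_sumr.
apply: big_ind => [||[b g] /ht /= hg]; [exact: AO0|exact: AOD|].
by rewrite trM; apply: AO_tr; exact: valuation_ringM.
Qed.

Lemma AO1 : AO 1.
Proof. exact/AO_tr/valuation_ring1. Qed.

Lemma AOX x n : AO x -> AO (x ^+ n).
Proof.
by move=> hx; elim: n => [|n IH]; [exact: AO1|rewrite exprS; exact: AOM].
Qed.

Lemma AON x : AO x -> AO (- x).
Proof.
move=> hx; rewrite -mulN1r; apply: AOM => //.
have -> : (-1 : AF iA iF) = trF (-1) 1.
  by apply/eqP; rewrite eq_sym -addr_eq0 -[X in _ + X]/(trF 1 1) -trDl addNr;
    apply/eqP/(addrI (trF 0 1)); rewrite -trDl !addr0.
exact/AO_tr/valuation_ring1.
Qed.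

Lemma l_integral_1BX w n : l_integral 1 (1 - w) -> l_integral 1 (1 - w ^+ n).
Proof.
move=> hw; have wO : AO w.
  by rewrite -[w](subKr 1); apply: AOD; [exact: AO1|exact/AON/(l_integral_AO hw)].
rewrite -opprB subrX1 -mulNr opprB mulrC; apply: l_integralM => //.
by apply: big_ind => [||i _]; [exact: AO0|exact: AOD|exact: AOX].
Qed.

Variable kappa : {rmorphism A -> Fp}.

(** If 1 is the sum of the f kappa(a) with a in l, then 1 minus the sum of the a (x) f equals the
    sum of the (1 (x) -f)(a (x) 1 - 1 (x) kappa(a)), which lies in j. *)
Lemma jO_unit_mod_l :
  ideal_gen (valuation_ring v) [set kappa a | a in l] = valuation_ring v ->
  exists2 w, jO v kappa w & l_integral 1 (1 - w).
Proof.
move=> l_unit; have : valuation_ring v 1 by exact: valuation_ring1.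
rewrite -l_unit => -[s [hs e1]].
have /choice[a ha] : forall z, exists a, z \in s -> l a /\ kappa a = z.2.
  move=> z; have [/hs[_ [a la ea]]|_] := boolP (z \in s); last by exists 0.
  by exists a.
exists (\sum_(z <- s) trF 1 (- z.1) * (trF (a z) 1 - trF 1 (kappa (a z)))).
  exists [seq (trF 1 (- z.1), trF (a z) 1 - trF 1 (kappa (a z))) | z <- s].
  split; last by rewrite big_map.
  move=> _ /mapP[z zs ->] /=; split; last by exists (a z).
  by apply: AO_tr; apply: (@valuation_geN _ _ dv 0); case: (hs z zs).
have N u f : trF u (- f) = - trF u f.
  apply/eqP; rewrite -addr_eq0 -trDr addNr; apply/eqP.
  by apply: (addrI (trF u 0)); rewrite -trDr !addr0.
have -> : 1 - \sum_(z <- s) trF 1 (- z.1) * (trF (a z) 1 - trF 1 (kappa (a z)))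
    = \sum_(z <- s) trF (a z) z.1.
  have -> : 1 = \sum_(z <- s) trF 1 (z.1 * kappa (a z)).
    rewrite [LHS](_ : _ = trF 1 1) // e1.
    have t0 : trF 1 0 = 0 by apply: (addrI (trF 1 0)); rewrite -trDr !addr0.
    rewrite (big_morph (trF 1) (trDr _ _ 1) t0) big_seq [RHS]big_seq.
    by apply: eq_bigr => z /ha[_ ->].
  rewrite -sumrB; apply: eq_bigr => z _.
  by rewrite N mulNr opprK mulrBr !trM !mul1r mulr1 addrC subrK.
exists [seq (a z, z.1) | z <- s]; split; last by rewrite big_map.
move=> _ /mapP[z zs ->] /=; split; first exact: ideal_pow1 (ha z zs).1.
by case: (hs z zs).
Qed.

Variable M : Amotive iA iF kappa.

Lemma model_scale (G : set M) b x : AO b -> Defs.span AO G x -> Defs.span AO G (b *: x).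
Proof.
move=> hb [s [hs ->]]; exists [seq (b * z.1, z.2) | z <- s]; split.
  by move=> _ /mapP[z /hs[h1 h2] ->]; split=> //; exact: AOM.
by rewrite big_map scaler_sumr; apply: eq_bigr => z _; rewrite scalerA.
Qed.

Lemma span_coordinates (G : seq M) x : Defs.span AO [set x | x \in G] x ->
  exists2 b : 'I_(size G) -> AF iA iF, forall i, AO (b i) & x = \sum_i b i *: G`_i.
Proof.
move=> [s [hs ->]]; elim: s hs => [|[b y] s IH] hs.
  exists (fun=> 0) => [i|]; first exact: AO0.
  by rewrite big_nil big1 // => i _; rewrite scale0r.
have [|c hc ec] := IH; first by move=> z hz; apply: hs; rewrite inE hz orbT.
have [/= hb yG] : AO b /\ y \in G by apply: (hs (b, y)); rewrite inE eqxx.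
have yi : (index y G < size G)%N by rewrite index_mem.
pose m := Ordinal yi.
exists (fun i => (if i == m then b else 0) + c i) => [i|].
  by apply: AOD => //; case: (i == m); [|exact: AO0].
rewrite big_cons /= ec (bigD1 m) //= [RHS](bigD1 m) //= eqxx nth_index // addrA -scalerDl.
by congr (_ + _); apply: eq_bigr => i /negPf ->; rewrite add0r.
Qed.

(** Since w^n is in j^n, it clears the denominators of x. Allowing every larger exponent lets
    several elements share one. *)
Lemma model_inv_pow (G : set M) w x : AO w -> jO v kappa w ->
  model_inv v (Defs.span AO G) x ->
  exists n, forall N, (n <= N)%N ->
    exists2 u, Defs.span AO G u & w ^+ N *: x = loc (jF kappa) u.
Proof.
move=> wO wj [n hn]; exists n => N /subnK <-.
have [|u Gu eu] := hn (w ^+ n).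
  exists [:: (1, w ^+ n)]; split; last by rewrite big_seq1 [_ *: _]mul1r.
  move=> z; rewrite inE => /eqP -> /=; split; first exact: AO1.
  by exists (fun=> w) => //; rewrite prodr_const card_ord.
exists (w ^+ (N - n) *: u); first by apply: model_scale => //; exact: AOX.
by rewrite exprD -scalerA eu linearZ.
Qed.

End IntegralTensors.

Lemma morph_add0 (V W : zmodType) (f : V -> W) : {morph f : x y / x + y} -> f 0 = 0.
Proof. by move=> fD; apply: (addrI (f 0)); rewrite -fD !addr0. Qed.

Lemma iota_tau_pinr1 (R : comPzRingType) (tau : {rmorphism R -> R}) (J : set R)
    (M : motive tau J) (m : germ J M) :
  iota_tau m (loc J (bc tau (pinr M (1 : R^o) : iota_mod M) 1))
  = germ_map J (pinl R^o) m + loc J (pinr M (1 : R^o) : iota_mod M).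
Proof.
rewrite /iota_tau /= !germ_map_loc /= !bc_mapE /=.
have -> : bc tau (0 : M) 1 = 0 by apply: (morph_add0 (bcDl _ _)).
by rewrite !linear0 add0r twist1E rmorph1 mulr1 gmul1.
Qed.

(** * Tate modules of the extensions given by iota *)

Section TateModule.
Variables (F : finFieldType) (A : comNzRingType) (iA : {rmorphism F -> A}).
Variables (Fp : fieldType) (iF : {rmorphism F -> Fp}) (kappa : {rmorphism A -> Fp}).
Variables (Fs : fieldType) (js : {rmorphism Fp -> Fs}) (l : set A).

Local Notation jF := (jF kappa).
Local Notation tauF := (tauF iA iF).
Local Notation AFl := (AFl iA iF js l).
Local Notation tauAl := (tauAl iA iF js l).
Local Notation Ml := (Ml js l).
Local Notation Mjl := (Mjl js l).

Lemma tate_tau_bc (M : Amotive iA iF kappa) (m : M) a :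
  tate_tau (bc AFl m a : Ml M) = bc AFl (mtau M (loc jF (bc tauF m 1))) (tauAl a).
Proof. exact: (tlift_pure _ _ (@tate_tau_bal _ _ _ _ _ _ _ js l M)). Qed.

Lemma tate_tauD (M : Amotive iA iF kappa) :
  {morph (@tate_tau F A iA Fp iF kappa Fs js l M) : x y / x + y}.
Proof. exact: (tliftD (@tate_tau_bal _ _ _ _ _ _ _ js l M)). Qed.

Lemma gal_act_bc (M : Amotive iA iF kappa) s (m : M) a :
  gal_act s (bc AFl m a : Ml M) = bc AFl m (galAl iA iF l s a).
Proof. exact: (tlift_pure _ _ (@gal_act_bal _ _ _ _ _ _ _ js l M s)). Qed.

Lemma gal_actD (M : Amotive iA iF kappa) s :
  {morph (@gal_act F A iA Fp iF kappa Fs js l M s) : x y / x + y}.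
Proof. exact: (tliftD (@gal_act_bal _ _ _ _ _ _ _ js l M s)). Qed.

Lemma bc_suml (R S : comPzRingType) (f : R -> S) (N : lmodType R) (I : finType)
    (n : I -> N) a :
  bc f (\sum_i n i) a = \sum_i bc f (n i) a.
Proof. exact: (big_morph (fun n => bc f n a) (bcDl _ _) (morph_add0 (bcDl _ _))). Qed.

Lemma bc_sumr (R S : comPzRingType) (f : R -> S) (N : lmodType R) (n : N)
    (I : finType) (a : I -> S) :
  bc f n (\sum_i a i) = \sum_i bc f n (a i).
Proof. exact: (big_morph (bc f n) (bcDr _ _) (morph_add0 (bcDr _ _))). Qed.

Lemma tate_tau_natural (M N : Amotive iA iF kappa) (h : {linear M -> N}) (z : Ml M) :
  is_motive_map h ->
  tate_tau (bc_map AFl h z : Ml N) = bc_map AFl (germ_map jF h) (tate_tau z).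
Proof.
move=> hM; move: z; apply: bc_eq_hom => [x y|x y|m a].
- by rewrite bc_mapD tate_tauD.
- by rewrite tate_tauD bc_mapD.
rewrite bc_mapE !tate_tau_bc bc_mapE /= hM germ_map_loc; congr bc.
by rewrite /= bc_mapE.
Qed.

Lemma gal_act_natural (M N : Amotive iA iF kappa) (h : {linear M -> N}) s (z : Ml M) :
  gal_act s (bc_map AFl h z : Ml N) = bc_map AFl h (gal_act s z).
Proof.
move: z; apply: bc_eq_hom => [x y|x y|m a].
- by rewrite bc_mapD gal_actD.
- by rewrite gal_actD bc_mapD.
by rewrite bc_mapE !gal_act_bc bc_mapE.
Qed.

Lemma bc_map_loc (M N : Amotive iA iF kappa) (h : {linear M -> N}) (z : Ml M) :
  bc_map AFl (loc jF) (bc_map AFl h z : Ml N)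
  = bc_map AFl (germ_map jF h) (bc_map AFl (loc jF) z).
Proof.
move: z; apply: bc_eq_hom => [x y|x y|m a]; first by rewrite !bc_mapD.
- by rewrite !bc_mapD.
by rewrite !bc_mapE /= germ_map_loc.
Qed.

Section Extension.
Variables (M : Amotive iA iF kappa) (m : germ jF M) (z : Ml M).
Let E : Amotive iA iF kappa := iota_ext m.
Let inM : {linear M -> E} := einc (iota_ext m).
Let pr : {linear E -> (AF iA iF)^o} := eproj (iota_ext m).
Let e1 : E := (pinr M (1 : (AF iA iF)^o) : iota_mod M).

Let e : Ml E := bc_map AFl inM z + bc AFl e1 1.

Lemma mtau_pinr1 : mtau E (loc jF (bc tauF e1 1)) = germ_map jF inM m + loc jF e1.
Proof.
exact: iota_tau_pinr1.
Qed.

(** The column of tau_E over the second summand is (m, 1), so the hypothesis is the first coordinate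
    of the fixed-point equation for (z, 1). It is stated over M[j^-1], where m lives. *)
Lemma tate_extension :
  tate_tau z + bc AFl m 1 = bc_map AFl (loc jF) z -> tate e.
Proof.
move=> h; rewrite /tate /= tate_tauD bc_mapD.
rewrite (tate_tau_natural _ (@einc_map _ _ _ _ (iota_ext m))) tate_tau_bc.
rewrite [bc_map AFl (loc jF) (bc_map _ _ _)](@bc_map_loc M E inM z) -h.
rewrite mtau_pinr1 rmorph1 bcDl bc_mapD -addrA; congr (_ + _).
by rewrite !bc_mapE.
Qed.

Lemma eproj_extension : bc_map AFl pr e = bc AFl (1 : (AF iA iF)^o) 1.
Proof.
rewrite bc_mapD bc_mapE [X in X + _](_ : _ = 0) ?add0r //.
move: z; apply: bc_eq_hom => [x y|x y|n a]; first by rewrite !bc_mapD.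
- by rewrite addr0.
by rewrite !bc_mapE; apply: (morph_add0 (bcDl _ _)).
Qed.

Lemma gal_act_extension s : gal_act s z = z -> gal_act s e = e.
Proof. by move=> h; rewrite gal_actD gal_act_natural h gal_act_bc rmorph1. Qed.

End Extension.

End TateModule.

Theorem theorem4p47
  (F : finFieldType)
  (K : fieldType) (iK : {rmorphism F -> K})
  (K_function_field : function_field iK)
  (K_geom_irr : geometrically_irreducible iK)
  (Pinf : set K) (Pinf_closed_point : closed_point Pinf)
  (A : comNzRingType) (iA : {rmorphism F -> A}) (jA : {rmorphism A -> K})
  (A_regular : regular_functions iK Pinf iA jA)
  (Fp : fieldType) (iF : {rmorphism F -> Fp}) (v : Fp -> int)
  (Fp_local : local_field v)
  (kappa : {rmorphism A -> Fp})
  (kappa_F : forall c, kappa (iA c) = iF c)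
  (kappa_Op : forall a, valuation_ring v (kappa a))
  (Fs : fieldType) (js : {rmorphism Fp -> Fs})
  (Fs_sep_closure : separable_closure js)
  (M : Amotive iA iF kappa)
  (l : set A) (l_maximal : maximal_ideal l)
  (l_unit : ideal_gen (valuation_ring v) [set kappa a | a in l] = valuation_ring v) :
  forall x : Ext1 M, Ext1_O v x -> Ext1_good v js l x.
Proof.
move=> x [L [[[[G LG] _ tauL] _] [m mL ->]]].
have [dv _ _] := Fp_local; have [jA_inj jA_iA _] := A_regular.
have [l_ideal _ _] := l_maximal.
have l_collide : forall a, exists i j, (i < j)%N /\ l (a ^+ i - a ^+ j).
  move=> a; apply: (powers_collide_mod_ideal K_function_field jA_inj jA_iA) => //.
  (* If l were 0, its image would generate the zero ideal and miss 1. *)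
  apply: contrapT => l0; have : valuation_ring v 1 by exact: valuation_ring1.
  rewrite -l_unit => -[s [hs /eqP]]; rewrite big_seq big1 ?oner_eq0 // => z.
  move=> /hs[_ [a' la' <-]]; have [->|a'0] := eqVneq a' 0.
    by rewrite rmorph0 scaler0.
  by case: l0; exists a'.
have [w wj w1] := jO_unit_mod_l iA iF dv l_unit.
have wO : AO v w.
  by rewrite -[w](subKr 1); apply: AOD; [exact: AO1|exact/(AON dv)/(l_integral_AO w1)].
pose r := size G; pose e (i : 'I_r) : M := G`_i.
pose taue i := mtau M (loc (jF kappa) (bc (tauF iA iF) (e i) 1)).
have /choice[n hn] : forall i, exists n, forall N, (n <= N)%N ->
    exists2 u, L u & w ^+ N *: taue i = loc (jF kappa) u.
  move=> i; rewrite LG; apply: model_inv_pow => //; rewrite -LG.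
  apply: tauL; last exact: AO1.
  rewrite LG; exists [:: (1, e i)]; split; last by rewrite big_seq1 scale1r.
  by move=> z; rewrite inE => /eqP -> /=; split; [exact: AO1|exact: mem_nth].
have [n0 hn0] : exists n, forall N, (n <= N)%N ->
    exists2 u, L u & w ^+ N *: m = loc (jF kappa) u.
  by rewrite LG; apply: model_inv_pow => //; rewrite -LG.
pose N := (n0 + \sum_i n i)%N; pose y := w ^+ N.
have /choice[b hb] : forall i, exists b : 'I_r -> AF iA iF, (forall j, AO v (b j)) /\
    y *: taue i = loc (jF kappa) (\sum_j b j *: e j).
  move=> i; have [|u Lu ->] := hn i N.
    by rewrite /N (bigD1 i) //= addnCA leq_addr.
  by move: Lu; rewrite LG => /span_coordinates[b hb ->]; exists b.
have [c hc em] : exists2 c : 'I_r -> AF iA iF, forall j, AO v (c j) &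
    y *: m = loc (jF kappa) (\sum_j c j *: e j).
  have [|u Lu ->] := hn0 N; first exact: leq_addr.
  by move: Lu; rewrite LG => /span_coordinates[c hc ->]; exists c.
have y1 : l_integral v l 1 (1 - y) by exact: l_integral_1BX.
(* The indices of [b] are swapped: [b j i] is the coefficient of [e i] in y tau_M(tau^* e_j), so it
   multiplies tau(a_j) in the i-th equation. *)
have [a ha a_inv] := completion_lang Fp_local Fs_sep_closure l_collide y1
  (B := fun i j => b j i) (fun i j => (hb j).1 i) hc.
pose z : Ml js l M := \sum_i bc (AFl iA iF js l) (e i) (a i).
(* Equality of coordinates with respect to the generators implies equality of the elements, after
   multiplication by y, which is a unit in [Al]. *)
have z_tate : tate_tau z + bc (AFl iA iF js l) m 1 = bc_map (AFl iA iF js l) (loc (jF kappa)) z.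
  have scale (t : germ (jF kappa) M) d s : y *: t = loc (jF kappa) (\sum_j d j *: e j) ->
      AFl iA iF js l y *: bc (AFl iA iF js l) t s
      = \sum_j bc (AFl iA iF js l) (loc (jF kappa) (e j)) (AFl iA iF js l (d j) * s).
    move=> et; rewrite bcZ -bc_bal et linear_sum bc_suml.
    by apply: eq_bigr => j _; rewrite linearZ bc_bal.
  have [y' y'y] := AFl_unit js Fp_local y1.
  have inj : injective (fun u : Mjl js l M => AFl iA iF js l y *: u).
    by move=> u u' /(congr1 (GRing.scale y')); rewrite !scalerA y'y !scale1r.
  apply: inj.
  have -> : tate_tau z = \sum_i (bc (AFl iA iF js l) (taue i)
                                   (tauAl iA iF js l (a i)) : Mjl js l M).
    have tD := @tate_tauD _ _ _ _ _ _ _ js l M.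
    rewrite (big_morph _ tD (morph_add0 tD)).
    by apply: eq_bigr => i _; rewrite tate_tau_bc.
  rewrite scalerDr scaler_sumr (scale _ _ _ em).
  under eq_bigr => i _ do rewrite (scale _ _ _ (hb i).2).
  have -> : bc_map (AFl iA iF js l) (loc (jF kappa)) z
      = \sum_j (bc (AFl iA iF js l) (loc (jF kappa) (e j)) (a j) : Mjl js l M).
    rewrite (big_morph _ (@bc_mapD _ _ _ _ _ _) (morph_add0 (@bc_mapD _ _ _ _ _ _))).
    by apply: eq_bigr => j _; rewrite bc_mapE.
  rewrite exchange_big -big_split scaler_sumr; apply: eq_bigr => j _ /=.
  by rewrite bcZ ha bcDr bc_sumr mulr1.
have z_inv s : inertia v s -> gal_act s z = z.
  move=> hs; rewrite /z (big_morph _ (gal_actD s) (morph_add0 (gal_actD s))).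
  by apply: eq_bigr => i _; rewrite gal_act_bc a_inv.
have tate0 : tate (0 : Ml js l M).
  by rewrite /tate /= (morph_add0 (@tate_tauD _ _ _ _ _ _ _ _ _ _)) linear0.
have gal0 s : gal_act s (0 : Ml js l M) = 0 by exact: (morph_add0 (gal_actD s)).
exists (iota_ext m); split; first exact: ext_equiv_refl.
(* The lift (z, 1) is fixed by inertia, so its connecting cocycle is zero on the nose. *)
exists (fun=> 0); last by exists 0 => // s _; rewrite gal0 subr0.
split.
  split=> [s _ //|s t _ _|k]; first by rewrite gal0 addr0.
  by exists [::] => s t _ _ _; rewrite subrr; exact: span0.
exists (bc_map (AFl iA iF js l) (einc (iota_ext m)) z
        + bc (AFl iA iF js l) (pinr M (1 : (AF iA iF)^o) : iota_mod M) 1); split.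
- exact: tate_extension.
- exact: eproj_extension.
by move=> s hs; rewrite gal_act_extension ?subrr ?linear0 // z_inv.
Qed.
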